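(* Let $G$ be a connected affine algebraic group with Lie algebra $\mathfrak g$, let $V$ be a finite-dimensional rational $G$-module, and let $\hat\phi:\mathrm{Mor}(V,\mathfrak g)\to\mathrm{Mor}(V,V)$ be given by $\hat\phi(F)(v)=F(v)\cdot v$. Set $\Omega_\phi=V_{reg}$ and $$E'_\phi=\{(v,x)\in\Omega_\phi\times\mathfrak g\mid x\cdot v=0\},$$ a vector bundle on $\Omega_\phi$. Suppose $E'_\phi$ is a trivial vector bundle and $\mathrm{codim}(V\setminus\Omega_\phi)\ge3$. Then $$\mathrm{Im}\,\hat\phi=\{\mathcal F\in\mathrm{Mor}(V,V)\mid\mathcal F(v)\in\mathfrak g\cdot v\ \ \forall v\in V\}.$$ In other words, if $\mathcal F\in\mathrm{Mor}(V,V)$ satisfies $\mathcal F(v)\in\mathfrak g\cdot v$ for all $v\in\Omega_\phi$, then there is $F\in\mathrm{Mor}(V,\mathfrak g)$ such that $\mathcal F(v)=F(v)\cdot v$ for all $v\in V$.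
   Context: The base field $\Bbbk$ is algebraically closed of characteristic $0$. $\mathrm{Mor}(V,N)$ is the $\Bbbk[V]$-module of polynomial morphisms $V\to N$ between finite-dimensional vector spaces. For $v\in V$, $\mathfrak g_v=\{x\in\mathfrak g\mid x\cdot v=0\}$ and $\mathfrak g\cdot v=\{x\cdot v\mid x\in\mathfrak g\}$. $V_{reg}$ is the dense open set of $v\in V$ with $\dim\mathfrak g_v$ minimal (equivalently, $\dim G\cdot v$ maximal). The empty set has codimension $\infty$. Triviality of $E'_\phi$ is as an algebraic vector bundle on $\Omega_\phi$ (a subbundle of $\Omega_\phi\times\mathfrak g$ with fibre $\mathfrak g_v$ over $v$). *)

(* Defs.v *)
(* Affine n-space over k is the type 'cV[k]_n of column vectors. *)
From HB Require Import structures.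
From mathcomp Require Import all_boot all_order all_algebra.
From mathcomp Require Import boolp classical_sets.
From mathcomp Require Import mpoly.
Set Implicit Arguments.
Unset Strict Implicit.
Unset Printing Implicit Defensive.
Import GRing.Theory.
Local Open Scope classical_set_scope.
Local Open Scope ring_scope.

Section AffineSpace.
Variable k : closedFieldType.

Definition peval n (p : {mpoly k[n]}) (v : 'cV[k]_n) : k :=
  p.@[fun i => v i 0].

(* Over the infinite field k, a polynomial map is the same thing as a tuple of
   polynomials. *)
Definition polymap n m (f : 'cV[k]_n -> 'cV[k]_m) : Prop :=
  exists p : 'I_m -> {mpoly k[n]}, forall v i, f v i 0 = peval (p i) v.

Definition Mor n m : set ('cV[k]_n -> 'cV[k]_m) := [set f | polymap f].

Definition zclosed n (Z : set 'cV[k]_n) : Prop :=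
  exists I : set {mpoly k[n]}, Z = [set v | forall p, I p -> peval p v = 0].

Definition zopen n (U : set 'cV[k]_n) : Prop := zclosed (~` U).

Definition zconnected n (S : set 'cV[k]_n) : Prop :=
  S !=set0 /\
  forall A B : set 'cV[k]_n, zclosed A -> zclosed B ->
    S `<=` A `|` B -> S `&` A `&` B = set0 ->
    S `&` A = set0 \/ S `&` B = set0.

Definition irreducible_closed n (Y : set 'cV[k]_n) : Prop :=
  [/\ zclosed Y, Y !=set0 &
      forall A B : set 'cV[k]_n, zclosed A -> zclosed B ->
        Y `<=` A `|` B -> Y `<=` A \/ Y `<=` B].

(* The codimension of an irreducible closed set Y in affine space is the
   supremum of the lengths l of the chains Y = C 0 < C 1 < ... < C l of
   irreducible closed sets, and codim Z is the infimum of codim Y over the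
   irreducible closed sets Y contained in Z (so the empty set has infinite
   codimension).  [codim_geq c Z] says that this infimum is at least c. *)
Definition codim_geq (c : nat) n (Z : set 'cV[k]_n) : Prop :=
  forall Y, irreducible_closed Y -> Y `<=` Z ->
  exists (l : nat) (C : nat -> set 'cV[k]_n),
    [/\ (c <= l)%N, C 0%N = Y,
        forall i, (i <= l)%N -> irreducible_closed (C i) &
        forall i, (i < l)%N -> C i `<` C i.+1].

(* Regular functions and maps on a (locally closed) subset S of affine space. *)
Definition regular_fun n (S : set 'cV[k]_n) (f : 'cV[k]_n -> k) : Prop :=
  forall s, S s -> exists (U : set 'cV[k]_n) (p q : {mpoly k[n]}),
    [/\ zopen U, U s &
        forall t, S t -> U t ->
          peval q t != 0 /\ f t = peval p t / peval q t].

Definition regular_map n m (S : set 'cV[k]_n) (f : 'cV[k]_n -> 'cV[k]_m) :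
  Prop := forall i, regular_fun S (fun v => f v i 0).

Section Bundle.
Variables (m N : nat) (S : set 'cV[k]_m) (E : 'cV[k]_m -> {vspace 'cV[k]_N}).

(* Total space of the family of subspaces (E v), v in S, of the trivial bundle
   S x k^N; the pair (v, x) is encoded as the vector col_mx v x. *)
Definition total_space : set 'cV[k]_(m + N) :=
  [set w | S (usubmx w) /\ dsubmx w \in E (usubmx w)].

(* Phi and Psi are mutually inverse morphisms over S between S x k^r and the
   total space, linear on the fibres. *)
Definition trivial_bundle : Prop :=
  exists (r : nat) (Phi : 'cV[k]_m -> 'cV[k]_r -> 'cV[k]_N)
         (Psi : 'cV[k]_m -> 'cV[k]_N -> 'cV[k]_r),
    [/\ regular_map [set w : 'cV[k]_(m + r) | S (usubmx w)]
          (fun w => Phi (usubmx w) (dsubmx w)),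
        regular_map total_space (fun w => Psi (usubmx w) (dsubmx w)) &
        forall v, S v ->
          [/\ forall a c d, Phi v (a *: c + d) = a *: Phi v c + Phi v d,
              forall c, Phi v c \in E v,
              forall c, Psi v (Phi v c) = c &
              forall x, x \in E v -> Phi v (Psi v x) = x]].
End Bundle.

(* Differential at a of the polynomial function p, in the direction x. *)
Definition ddiff n (p : {mpoly k[n]}) (a x : 'cV[k]_n) : k :=
  \sum_(l < n) x l 0 * peval (p^`M(l)) a.

Lemma ddiff_linear n (p : {mpoly k[n]}) a c x y :
  ddiff p a (c *: x + y) = c * ddiff p a x + ddiff p a y.
Proof.
rewrite /ddiff mulr_sumr -big_split; apply: eq_bigr => l _ /=.
by rewrite !mxE mulrDl mulrA.
Qed.

Lemma vspace_exists n (P : 'cV[k]_n -> Prop) :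
    P 0 -> (forall c x y, P x -> P y -> P (c *: x + y)) ->
  exists U : {vspace 'cV[k]_n}, forall x, x \in U <-> P x.
Proof.
move=> P0 Plin.
pose D (d : nat) :=
  `[< exists2 U : {vspace 'cV[k]_n}, forall x, x \in U -> P x & \dim U = d >].
have exD : exists d, D d.
  exists 0%N; apply/asboolP; exists 0%VS; last by rewrite dimv0.
  by move=> x; rewrite memv0 => /eqP->.
have ubD d : D d -> (d <= \dim {: 'cV[k]_n})%N.
  by move=> /asboolP[U _ <-]; apply/dimvS/subvf.
case: (ex_maxnP exD ubD) => d /asboolP[U UP dU] maxd.
exists U => x; split=> [/UP//|Px].
have UxP y : y \in (<[x]> + U)%VS -> P y.
  by case/memv_addP=> _ /vlineP[c ->] [u uU ->]; apply: Plin => //; exact: UP.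
have /eqP -> : U == (<[x]> + U)%VS.
  rewrite eqEdim addvSr dU /=; apply: maxd.
  by apply/asboolP; exists (<[x]> + U)%VS.
by rewrite (subvP (addvSl _ _)) ?memv_line.
Qed.

End AffineSpace.

Arguments Mor {k} n m _.

(* The group law and the inversion are morphisms on the closed subset
   ag_carrier of affine space, i.e. restrictions of polynomial maps; their
   values outside ag_carrier are irrelevant. *)
Record affine_alggroup (k : closedFieldType) := AffineAlgGroup {
  ag_dim : nat;
  ag_carrier : set 'cV[k]_ag_dim;
  ag_one : 'cV[k]_ag_dim;
  ag_mul : 'cV[k]_ag_dim -> 'cV[k]_ag_dim -> 'cV[k]_ag_dim;
  ag_inv : 'cV[k]_ag_dim -> 'cV[k]_ag_dim;
  ag_closed : zclosed ag_carrier;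
  ag_mul_poly : polymap (fun w : 'cV[k]_(ag_dim + ag_dim) =>
                           ag_mul (usubmx w) (dsubmx w));
  ag_inv_poly : polymap ag_inv;
  ag_oneP : ag_carrier ag_one;
  ag_mulP : forall g h,
    ag_carrier g -> ag_carrier h -> ag_carrier (ag_mul g h);
  ag_invP : forall g, ag_carrier g -> ag_carrier (ag_inv g);
  ag_mulA : forall g h l,
    ag_carrier g -> ag_carrier h -> ag_carrier l ->
    ag_mul g (ag_mul h l) = ag_mul (ag_mul g h) l;
  ag_mul1g : forall g, ag_carrier g -> ag_mul ag_one g = g;
  ag_mulVg : forall g, ag_carrier g -> ag_mul (ag_inv g) g = ag_one }.

Arguments ag_carrier {k} _ _.
Arguments ag_mul {k} _ _ _.
Arguments ag_inv {k} _ _.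

Definition connected_alggroup k (G : affine_alggroup k) : Prop :=
  zconnected (ag_carrier G).

(* A rational G-module structure on k^m: a homomorphism g |-> rm_at g from G
   to GL_m whose matrix coefficients are the restrictions to G of the
   polynomials rm_mx i j. *)
Record rational_module k (G : affine_alggroup k) (m : nat) := RationalModule {
  rm_mx : 'I_m -> 'I_m -> {mpoly k[ag_dim G]};
  rm_at := fun g : 'cV[k]_(ag_dim G) =>
             \matrix_(i, j) peval (rm_mx i j) g : 'M[k]_m;
  rm_one : rm_at (ag_one G) = 1%:M;
  rm_mul : forall g h, ag_carrier G g -> ag_carrier G h ->
    rm_at (ag_mul G g h) = rm_at g *m rm_at h }.

Section LieAlgebra.
Variables (k : closedFieldType) (G : affine_alggroup k).
Notation N := (ag_dim G).

Definition tangent_one (x : 'cV[k]_N) : Prop :=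
  forall p : {mpoly k[N]}, (forall g, ag_carrier G g -> peval p g = 0) ->
    ddiff p (ag_one G) x = 0.

Lemma tangent_one_vspace :
  exists U : {vspace 'cV[k]_N}, forall x, x \in U <-> tangent_one x.
Proof.
apply: vspace_exists => [p _|c x y tx ty p pG].
  by rewrite /ddiff big1 // => l _; rewrite mxE mul0r.
by rewrite ddiff_linear tx // ty // mulr0 addr0.
Qed.

(* The vector space underlying the Lie algebra: the tangent space at 1. *)
Definition lie_algebra : {vspace 'cV[k]_N} := sval (cid tangent_one_vspace).

Lemma lie_algebraP x : x \in lie_algebra <-> tangent_one x.
Proof. exact: (svalP (cid tangent_one_vspace)). Qed.

Variables (m : nat) (rho : rational_module G m).

(* The matrix of the differential at 1 of the representation, in the direction
   x.  For x in the Lie algebra it only depends on the restriction to G of the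
   polynomials rm_mx. *)
Definition lie_mx (x : 'cV[k]_N) : 'M[k]_m :=
  \matrix_(i, j) ddiff (rm_mx rho i j) (ag_one G) x.

Definition lie_act (x : 'cV[k]_N) (v : 'cV[k]_m) : 'cV[k]_m := lie_mx x *m v.

Definition lie_act_at (v : 'cV[k]_m) (x : 'cV[k]_N) := lie_act x v.

Fact lie_act_at_linear v : linear (lie_act_at v).
Proof.
move=> c x y; rewrite /lie_act_at /lie_act.
have -> : lie_mx (c *: x + y) = c *: lie_mx x + lie_mx y.
  by apply/matrixP=> i j; rewrite !mxE ddiff_linear.
by rewrite mulmxDl -scalemxAl.
Qed.

HB.instance Definition _ v :=
  GRing.isLinear.Build k 'cV[k]_N 'cV[k]_m _ (lie_act_at v)
    (lie_act_at_linear v).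

Definition lie_stab (v : 'cV[k]_m) : {vspace 'cV[k]_N} :=
  (lie_algebra :&: lker (linfun (lie_act_at v)))%VS.

Lemma lie_stabP v x :
  x \in lie_stab v <-> x \in lie_algebra /\ lie_act x v = 0.
Proof.
rewrite memv_cap memv_ker lfunE /=.
by split=> [/andP[-> /eqP]|[-> /eqP]].
Qed.

Definition lie_orbit (v : 'cV[k]_m) : set 'cV[k]_m :=
  [set lie_act x v | x in [set x | x \in lie_algebra]].

Definition Vreg : set 'cV[k]_m :=
  [set v | forall w, (\dim (lie_stab v) <= \dim (lie_stab w))%N].

(* Mor(V, g), as polynomial maps from V to the ambient space of g with values
   in g. *)
Definition Mor_lie : set ('cV[k]_m -> 'cV[k]_N) :=
  [set F | Mor m N F /\ forall v, F v \in lie_algebra].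

Definition phi_hat (F : 'cV[k]_m -> 'cV[k]_N) : 'cV[k]_m -> 'cV[k]_m :=
  fun v => lie_act (F v) v.

End LieAlgebra.

Arguments lie_algebra {k} G.
Arguments Mor_lie {k} G m _.

(* Main.v *)
(* Let D be the ideal of the polynomials f such that f F = H . v for some
   morphism H with values in g.  By Cramer's rule, applied to local bases of the
   spaces g.v, its zeros lie outside V_reg.  Since the codimension is at least 3,
   Noether normalization gives a regular sequence h_1, h_2, h_3 in D, say with
   h_i F = H_i . v.  The morphisms h_i H_j - h_j H_i are sections of the bundle
   of stabilizers.  Regular functions on V_reg are polynomial (codimension 2), so
   a trivialization makes these sections a free module over k[V].  Exactness of
   the Koszul complex of h_1, h_2, h_3 at their coordinates (in place of the
   vanishing of H^1(V_reg, O)) allows one to correct H_1 and H_2 by sections so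
   that h_1 H_2 = h_2 H_1; then h_1 divides H_1, and H_1 / h_1 is the required
   lift. *)
From HB Require Import structures.
Require Import Defs.
From mathcomp Require Import all_boot all_order all_algebra.
From mathcomp Require Import boolp classical_sets.
From mathcomp Require Import mpoly ring.
Set Implicit Arguments.
Unset Strict Implicit.
Unset Printing Implicit Defensive.
Import GRing.Theory.
Local Open Scope classical_set_scope.
Local Open Scope ring_scope.

(** * Prime ideals of polynomial rings *)

(** The codimension is given by chains of irreducible closed sets, while the Koszul argument needs
    polynomials. The passage goes through prime ideals. With at least two variables, two shears turn
    the polynomial ring into [{poly {poly C}}], where [C] is the polynomial ring in the remaining
    variables. If the ideal met [C] only in 0, Zorn's lemma would give a prime containing it that
    still meets [C] only in 0 and is the ideal of its own zeros. Codimension 3 puts three more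
    primes strictly below it, one too many for two variables over the fraction field of [C].
    Regularity of the resulting triple is then plain division by monic polynomials. The same result,
    applied to the denominators of a regular function on V_reg, yields its polynomial extension.
    Identities between polynomial maps are checked only where one fixed nonzero polynomial does not
    vanish. *)

Section Ideals.
Variable R : comNzRingType.

Definition is_ideal (I : set R) : Prop :=
  [/\ I 0, forall x y, I x -> I y -> I (x + y) & forall a x, I x -> I (a * x)].

Definition is_prime (P : set R) : Prop :=
  [/\ is_ideal P, ~ P 1 & forall x y, P (x * y) -> P x \/ P y].

Lemma idealD I x y : is_ideal I -> I x -> I y -> I (x + y).
Proof. by case=> _ ID _; exact: ID. Qed.

Lemma idealMl I a x : is_ideal I -> I x -> I (a * x).
Proof. by case=> _ _ IM; exact: IM. Qed.

Lemma idealMr I a x : is_ideal I -> I x -> I (x * a).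
Proof. by move=> II Ix; rewrite mulrC; exact: idealMl. Qed.

Lemma idealN I x : is_ideal I -> I x -> I (- x).
Proof. by move=> II Ix; rewrite -mulN1r; exact: idealMl. Qed.

Lemma idealB I x y : is_ideal I -> I x -> I y -> I (x - y).
Proof. by move=> II Ix Iy; apply: idealD => //; exact: idealN. Qed.

Lemma idealBl I x y : is_ideal I -> I (x - y) -> I y -> I x.
Proof. by move=> II Ixy Iy; rewrite -(subrK y x); exact: idealD. Qed.

Lemma prime_exp P x n : is_prime P -> P (x ^+ n) -> P x.
Proof.
move=> [_ P1 PM]; elim: n => [|n IHn]; first by rewrite expr0.
by rewrite exprS => /PM[].
Qed.

Lemma prime_expM P x n y : is_prime P -> ~ P x -> P (x ^+ n * y) -> P y.
Proof. by move=> Pp nPx; case: (Pp) => _ _ /[apply] -[/(prime_exp Pp)|]. Qed.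

Lemma maximal_ideal_disjoint (I S : set R) : is_ideal I -> I `&` S = set0 ->
  exists P : set R, [/\ is_ideal P, I `<=` P, P `&` S = set0 &
    forall J, is_ideal J -> P `<=` J -> J `&` S = set0 -> J `<=` P].
Proof.
move=> II IS0.
pose good (X : set R) := [/\ is_ideal X, I `<=` X & X `&` S = set0].
(* [set0] is admitted so that the empty chain has a union in the family. *)
have [F sF totF|P [P0 maxP]] := @Zorn_bigcup R [set X | X = set0 \/ good X].
- have [F0|] := pselect (forall X, F X -> X = set0).
    by left; apply/seteqP; split=> // x [X /F0 ->].
  move=> /existsNP[X0 /not_implyP[FX0 X0n]].
  have gX0 : good X0 by case: (sF _ FX0) => // /X0n.
  have big X Y : F X -> F Y -> X !=set0 ->
      exists Z, [/\ F Z, good Z, X `<=` Z & Y `<=` Z].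
    move=> FX FY [x Xx].
    have gX : good X by case: (sF _ FX) => // X_0; rewrite X_0 in Xx.
    have [XY|YX] := totF _ _ FX FY; last by exists X; split=> // z.
    exists Y; split=> //; case: (sF _ FY) => // Y0.
    by move: (XY _ Xx); rewrite Y0 => -[].
  right; split.
  + split.
    * by exists X0 => //; case: gX0 => -[].
    * move=> x y [X FX Xx] [Y FY Yy].
      have [Z [FZ [IZ _ _] XZ YZ]] := big X Y FX FY (ex_intro _ x Xx).
      by exists Z => //; apply: idealD => //; [exact: XZ|exact: YZ].
    * move=> a x [X FX Xx].
      have [Z [FZ [IZ _ _] XZ _]] := big X X FX FX (ex_intro _ x Xx).
      by exists Z => //; apply: idealMl => //; exact: XZ.
  + by move=> x Ix; exists X0 => //; case: gX0 => _ + _; exact.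
  + apply/seteqP; split=> // x [[X FX Xx] Sx].
    have [Z [FZ [_ _ <-] XZ _]] := big X X FX FX (ex_intro _ x Xx).
    by split=> //; exact: XZ.
- have [I0 _ _] := II.
  case: P0 => [P0|[IP IsP PS0]].
    case: (maxP I); last by right; split.
    by rewrite P0; split=> // /(_ _ I0).
  exists P; split=> // J IJ PJ JS0 x Jx; apply: contrapT => nPx.
  apply: (maxP J); last by right; split=> //; exact: subset_trans PJ.
  by split=> // /(_ _ Jx).
Qed.

(** If neither [x] nor [y] is in [P], both [P + (x)] and [P + (y)] meet [S]; the product of two such
    elements is in [S], and would be in [P] if [x * y] were. *)
Lemma prime_of_maximal_disjoint (P S : set R) : is_ideal P ->
    P `&` S = set0 -> S 1 -> (forall x y, S x -> S y -> S (x * y)) ->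
    (forall J, is_ideal J -> P `<=` J -> J `&` S = set0 -> J `<=` P) ->
  is_prime P.
Proof.
move=> IP PS0 S1 SM maxP; have [P0 _ _] := IP.
have notPS x : P x -> ~ S x.
  by move=> Px Sx; have : (P `&` S) x by []; rewrite PS0 => -[].
split=> // [/notPS//|x y Pxy].
have meet z : ~ P z -> exists p a, P p /\ S (p + a * z).
  move=> nPz; apply: contrapT => nex; apply: nPz.
  apply: (maxP [set w | exists p a, P p /\ w = p + a * z]).
  - split.
    + by exists 0, 0; rewrite mul0r addr0.
    + move=> _ _ [p [a [Pp ->]]] [q [b [Pq ->]]]; exists (p + q), (a + b).
      by split; [exact: idealD|rewrite mulrDl addrACA].
    + move=> c _ [p [a [Pp ->]]]; exists (c * p), (c * a).
      by split; [exact: idealMl|rewrite mulrDr mulrA].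
  - by move=> w Pw; exists w, 0; rewrite mul0r addr0.
  - apply/seteqP; split=> // _ [[p [a [Pp ->]]] Sw].
    by case: nex; exists p, a.
  - by exists 0, 1; rewrite mul1r add0r.
have [Px|/meet[p [a [Pp Sp]]]] := pselect (P x); first by left.
right; apply: contrapT => /meet[q [b [Pq Sq]]].
apply: (notPS _ _ (SM _ _ Sp Sq)).
rewrite mulrDl mulrDr; apply: idealD => //.
  by apply: idealD => //; [exact: idealMl|exact: idealMr].
rewrite mulrDr; apply: idealD => //; first exact: idealMl.
by rewrite mulrACA; exact: idealMl.
Qed.
End Ideals.

Lemma preim_ideal (R R' : comNzRingType) (f : {rmorphism R -> R'}) I :
  is_ideal I -> is_ideal (f @^-1` I).
Proof.
move=> [I0 ID IM]; split=> [|x y Ix Iy|a x Ix] /=.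
- by rewrite /preimage /= rmorph0.
- by rewrite /preimage /= rmorphD; exact: ID.
- by rewrite /preimage /= rmorphM; exact: IM.
Qed.

Lemma preim_prime (R R' : comNzRingType) (f : {rmorphism R -> R'}) P :
  is_prime P -> is_prime (f @^-1` P).
Proof.
move=> [IP P1 PM]; split; first exact: preim_ideal.
  by rewrite /preimage /= rmorph1.
by move=> x y; rewrite /preimage /= rmorphM => /PM.
Qed.

Lemma ltn_predn_addn i j : (1 < j)%N -> (i < (i + j).-1)%N.
Proof. by case: j => [|[|j]] // _; rewrite !addnS ltnS leq_addr. Qed.

(** * Primes of a polynomial ring and their contractions *)

Section PolyPrimes.
Variable B : idomainType.
Implicit Types P Q : set {poly B}.

Lemma size_sub_lead (p : {poly B}) : p != 0 ->
  (size (p - lead_coef p *: 'X^((size p).-1))%R < size p)%N.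
Proof.
move=> p0; have sp : (0 < size p)%N by rewrite size_poly_gt0.
rewrite -(prednK sp) ltnS; apply/leq_sizeP => j.
rewrite leq_eqVlt coefB coefZ coefXn => /orP[/eqP<-|lt_j].
  by rewrite eqxx mulr1 subrr.
by rewrite gtn_eqF // mulr0 subr0 nth_default // -(prednK sp).
Qed.

Lemma exists_min_size P : P !=set0 -> exists p, P p /\
  forall q, P q -> (size p <= size q)%N.
Proof.
move=> [p0 Pp0]; pose D n := `[< exists p, P p /\ size p = n >].
have exD : exists n, D n by exists (size p0); apply/asboolP; exists p0.
have [n /asboolP[p [Pp <-]] minp] := ex_minnP exD.
by exists p; split=> // q Pq; apply: minp; apply/asboolP; exists q.
Qed.

(* Elements of least degree in [P] outside [Q] and in [Q] with leading
   coefficient outside [Q] are compared by pseudo-division. *)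
Lemma prime_sub_of_lead P Q (p : {poly B}) : is_prime P -> is_prime Q ->
    Q `<=` P -> (forall b, P b%:P -> Q b%:P) ->
    Q p -> ~ Q (lead_coef p)%:P -> P `<=` Q.
Proof.
move=> prP prQ QP PBQ Qp nQlp; apply: contrapT => nPQ.
have [[IP _ _] [IQ _ QM]] := (prP, prQ).
have [{Qp nQlp}p [[Qp nQlp] minp]] :
    exists p, (Q p /\ ~ Q (lead_coef p)%:P) /\
      forall q, Q q /\ ~ Q (lead_coef q)%:P -> (size p <= size q)%N.
  by apply: (@exists_min_size [set q | Q q /\ ~ Q (lead_coef q)%:P]); exists p.
have [g [[Pg nQg] ming]] : exists g, (P g /\ ~ Q g) /\
      forall q, P q /\ ~ Q q -> (size g <= size q)%N.
  apply: (@exists_min_size [set q | P q /\ ~ Q q]).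
  by move: nPQ => /existsNP[g /not_implyP]; exists g.
have Q0 : Q 0 by case: IQ.
have g0 : g != 0 by apply: contra_not_neq nQg => ->.
have p0 : p != 0 by apply: contra_not_neq nQlp => ->; rewrite lead_coef0.
have small r : P r -> (size r < size g)%N -> Q r.
  by move=> Pr; apply: contraPP => nQr; apply/negP; rewrite -leqNgt; exact: ming.
(* Otherwise dropping the leading term of [g] leaves a shorter element of [P], which is in [Q]. *)
have nQlg : ~ Q (lead_coef g)%:P.
  move=> Qlg; apply: nQg; rewrite -[g](subrK (lead_coef g *: 'X^((size g).-1))).
  have Qt : Q (lead_coef g *: 'X^((size g).-1)).
    by rewrite -mul_polyC; exact: idealMr.
  apply: idealD => //; apply: small; last exact: size_sub_lead.
  by apply: idealB => //; exact: QP.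
have nQX x s y : ~ Q x%:P -> Q ((x ^+ s) *: y) -> Q y.
  by move=> nQx; rewrite -mul_polyC rmorphXn; exact: prime_expM.
(* If [p] is shorter, the pseudo-remainder of [g] by [p] is in [P] and shorter than [g], hence in
   [Q]; so is a power of [lead_coef p] times [g]. *)
case: (ltnP (size p) (size g)) => [lt_pg|le_gp].
  have Dg := Pdiv.ComRing.rdivp_eq p g.
  apply/nQg/(nQX _ (Pdiv.CommonRing.rscalp g p) _ nQlp); rewrite Dg.
  apply: idealD => //; first exact: idealMl.
  apply: small; last first.
    by apply: ltn_trans lt_pg; rewrite Pdiv.CommonRing.ltn_rmodp.
  have -> : Pdiv.CommonRing.rmodp g p =
    (lead_coef p ^+ Pdiv.CommonRing.rscalp g p) *: g -
      Pdiv.CommonRing.rdivp g p * p by rewrite Dg addrC addKr.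
  apply: idealB => //; first by rewrite -mul_polyC; exact: idealMl.
  by apply: idealMl => //; exact: QP.
have Dp := Pdiv.ComRing.rdivp_eq g p.
set s := Pdiv.CommonRing.rscalp p g in Dp.
set a := Pdiv.CommonRing.rdivp p g in Dp.
set r := Pdiv.CommonRing.rmodp p g in Dp.
have lt_rg : (size r < size g)%N by rewrite Pdiv.CommonRing.ltn_rmodp.
have Qr : Q r.
  apply: small => //; rewrite -[r](addKr (a * g)) -Dp addrC.
  apply: idealB => //; first by rewrite -mul_polyC; apply: idealMl => //; exact: QP.
  exact: idealMl.
have Qa : Q a.
  have : Q (a * g); last by case/QM.
  rewrite -[a * g](addrK r) -Dp.
  by apply: idealB => //; rewrite -mul_polyC; exact: idealMl.
have cs0 : lead_coef g ^+ s != 0 by rewrite expf_neq0 // lead_coef_eq0.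
have a0 : a != 0.
  apply: contraTneq le_gp => a0; rewrite -ltnNge -(size_scale p cs0) Dp a0.
  by rewrite mul0r add0r.
have lt_r : (size r < size (a * g)%R)%N.
  by rewrite (leq_trans lt_rg) // size_mul // (polySpred a0) addSn leq_addl.
have g1 : (1 < size g)%N.
  rewrite ltnNge; apply/negP => /size1_polyC Dg; apply: nQg.
  by rewrite Dg; apply: PBQ; rewrite -Dg.
(* The quotient [a] competes with [p]: it is in [Q], its leading coefficient is not, and it is
   shorter than [p] because [g] is not constant. *)
have : (size p <= size a)%N.
  apply: minp; split=> // Qla; apply: nQlp; apply: (nQX _ s _ nQlg).
  rewrite -mul_polyC -polyCM.
  have -> : lead_coef g ^+ s * lead_coef p = lead_coef a * lead_coef g.
    by rewrite -lead_coefM -(lead_coefDl lt_r) -Dp lead_coefZ.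
  by rewrite polyCM; exact: idealMr.
apply/negP; rewrite -ltnNge -(size_scale p cs0) Dp size_polyDl // size_mul //.
exact: ltn_predn_addn.
Qed.

(** Primes meeting [B] only in 0 correspond to primes over the fraction field, where every nonzero
    prime is maximal. *)
Lemma prime_sub_of_neq0 P Q : is_prime P -> is_prime Q -> Q `<=` P ->
  (forall b, P b%:P -> b = 0) -> (exists2 q, Q q & q != 0) -> P `<=` Q.
Proof.
move=> prP prQ QP PB0 [q Qq q0]; have [[Q0 _ _] _ _] := prQ.
apply: (prime_sub_of_lead (p := q)) => // [b /PB0->//|/QP/PB0/eqP].
by rewrite lead_coef_eq0 (negbTE q0).
Qed.

(** The smaller of two distinct nested primes with the same contraction is extended from [B]: by
    [prime_sub_of_lead] all its leading coefficients belong to it, and leading terms can be removed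
    one by one. *)
Lemma prime_coef_of_proper P Q (p : {poly B}) : is_prime P -> is_prime Q ->
    Q `<=` P -> (forall b, P b%:P -> Q b%:P) -> ~ (P `<=` Q) ->
  Q p -> forall i, Q (p`_i)%:P.
Proof.
move=> prP prQ QP PBQ nPQ; have [IQ _ _] := prQ; have [Q0 _ _] := IQ.
have [n] := ubnP (size p); elim: n p => // n IHn p lt_pn Qp i.
have [->|p0] := eqVneq p 0; first by rewrite coef0.
have Ql : Q (lead_coef p)%:P.
  by apply: contrapT => nQl; apply: nPQ; exact: (prime_sub_of_lead (p := p)).
have := IHn (p - lead_coef p *: 'X^((size p).-1)) _ _ i.
rewrite coefB polyCB => IHi; apply: (idealBl IQ); first apply: IHi.
- by rewrite -ltnS (leq_trans _ lt_pn) // ltnS size_sub_lead.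
- by apply: idealB => //; rewrite -mul_polyC; exact: idealMr.
- by rewrite coefZ polyCM; exact: idealMr.
Qed.
End PolyPrimes.

Section BivariatePrimes.
Variable C : idomainType.

(** Two variables over the fraction field of [C] have dimension 2. Here [P1] and [P0] share a
    nonzero contraction to [{poly C}], so [P1] is extended from it and, up to constants of [C],
    generated by one [a]; since [P2] contracts to 0, its elements could be divided by [a]
    forever. *)
Lemma no_prime_chain3 (P2 P1 P0 : set {poly {poly C}}) :
    is_prime P0 -> is_prime P1 -> is_prime P2 ->
    P1 `<=` P0 -> ~ (P0 `<=` P1) -> P2 `<=` P1 -> ~ (P1 `<=` P2) ->
    (exists2 p, P2 p & p != 0) -> (forall c, P0 c%:P%:P -> c = 0) -> False.
Proof.
move=> prP0 prP1 prP2 P10 nP01 P21 nP12 [p P2p p0] P0C.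
pose cont (P : set {poly {poly C}}) : set {poly C} := polyC @^-1` P.
have contP P : is_prime P -> is_prime (cont P) by exact: preim_prime.
have cont0 P : P `<=` P1 -> P2 `<=` P -> is_prime P -> ~ (P1 `<=` P) ->
  (exists2 p, P p & p != 0) -> exists2 b, P1 b%:P & b != 0.
  move=> PP1 P2P prP nP1P Pn0; apply: contrapT => nb; apply: nP1P.
  apply: prime_sub_of_neq0 => // b P1b; apply/eqP; apply: contra_notT nb.
  by exists b.
have [b P1b b0] : exists2 b, P1 b%:P & b != 0.
  by apply: (cont0 P2) => //; exists p.
have P1B b' : P0 b'%:P -> P1 b'%:P.
  move=> P0b'; apply: (prime_sub_of_neq0 (contP _ prP0) (contP _ prP1)) => //.
  - by move=> ? ?; exact: P10.
  - by exists b.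
have P1coef q : P1 q -> forall i, P1 (q`_i)%:P.
  by move=> P1q; exact: (prime_coef_of_proper (P := P0)).
have P2B b' : P2 b'%:P -> b' = 0.
  move=> P2b'; apply/eqP; apply: contra_notT nP12 => b'0 q /P1coef P1q.
  have [IP2 _ _] := prP2; rewrite -[q]coefK poly_def.
  elim/big_ind: _ => [|x y|i _]; first by case: IP2.
    exact: idealD.
  rewrite -mul_polyC; apply: idealMr => //.
  apply: (prime_sub_of_neq0 (contP _ prP1) (contP _ prP2)) (P1q i) => //.
  - by move=> ? ?; exact: P21.
  - by move=> c /P10/P0C.
  - by exists b'.
have [a [[P1a a0] mina]] : exists a, (P1 a%:P /\ a != 0) /\
    forall c, P1 c%:P /\ c != 0 -> (size a <= size c)%N.
  by apply: (@exists_min_size _ [set c | P1 c%:P /\ c != 0]); exists b.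
have [IP1 _ _] := prP1; have [P10' _ _] := IP1.
have a1 : (1 < size a)%N.
  rewrite ltnNge; apply/negP => /size1_polyC Da.
  by move: P1a a0; rewrite Da => /P10/P0C->; rewrite eqxx.
(* Up to a nonzero factor from [C], the generator [a] of the contraction of
   [P1] divides every element of [P1]. *)
have div_a (q : {poly {poly C}}) : (forall i, P1 (q`_i)%:P) ->
    exists (c : C) q', c != 0 /\ c%:P%:P * q = a%:P * q'.
  elim/poly_ind: q => [|q d IHq] Pq.
    by exists 1, 0; rewrite oner_neq0 !mulr0.
  have [i|c [q' [c0 Dq]]] := IHq.
    by have := Pq i.+1; rewrite coefD coefMX coefC addr0.
  have P1d : P1 d%:P by have := Pq 0%N; rewrite coefD coefMX coefC add0r.
  have Dd := Pdiv.ComRing.rdivp_eq a d.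
  set e := lead_coef a ^+ _ in Dd.
  have e0 : e != 0 by rewrite expf_neq0 // lead_coef_eq0.
  have r0 : Pdiv.CommonRing.rmodp d a = 0.
    apply/eqP; apply: contraT => r0.
    have := Pdiv.CommonRing.ltn_rmodp d a; rewrite a0 ltnNge mina //; split=> //.
    rewrite -[Pdiv.CommonRing.rmodp d a](addKr (Pdiv.CommonRing.rdivp d a * a)).
    rewrite -Dd addrC polyCB polyCM; apply: idealB => //.
      by rewrite -mul_polyC polyCM; exact: idealMl.
    exact: idealMl.
  rewrite r0 addr0 in Dd.
  exists (c * e), (e%:P%:P * q' * 'X + c%:P%:P * (Pdiv.CommonRing.rdivp d a)%:P).
  split; first by rewrite mulf_neq0.
  rewrite !mulrDr !polyCM; congr (_ + _).
    by rewrite [RHS]mulrA [a%:P * _]mulrCA -Dq !mulrA [c%:P%:P * _]mulrC.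
  rewrite -mulrA [RHS]mulrCA; congr (_ * _).
  by rewrite -!polyCM mul_polyC Dd mulrC.
(* The descent measures the degree of the leading coefficient in the inner variable. Division by [a]
   lowers it, and stays in [P2] because [a] is not in [P2]. *)
have [q [[P2q q0] minq]] : exists q, (P2 q /\ q != 0) /\
    forall q', P2 q' /\ q' != 0 -> (size (lead_coef q) <= size (lead_coef q'))%N.
  pose D n := `[< exists q, (P2 q /\ q != 0) /\ size (lead_coef q) = n >].
  have exD : exists n, D n.
    by exists (size (lead_coef p)); apply/asboolP; exists p.
  have [n /asboolP[q [qP <-]] minq] := ex_minnP exD.
  by exists q; split=> // q' q'P; apply: minq; apply/asboolP; exists q'.
have [c [q' [c0 Dq]]] := div_a q (P1coef _ (P21 _ P2q)).
have cq0 : c%:P%:P * q != 0 by rewrite mulf_neq0 // !polyC_eq0.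
have q'0 : q' != 0 by move: cq0; rewrite Dq mulf_eq0 => /norP[].
have : (size (lead_coef q) <= size (lead_coef q'))%N.
  apply: minq; split=> //; case: (prP2) => IP2 _ P2M.
  have : P2 (a%:P * q') by rewrite -Dq; exact: idealMl.
  by case/P2M => // /P2B/eqP; rewrite (negbTE a0).
apply/negP; rewrite -ltnNge.
have := congr1 (fun r : {poly {poly C}} => size (lead_coef r)) Dq.
rewrite !lead_coefM !lead_coefC mul_polyC size_scale // => ->.
by rewrite size_mul ?lead_coef_eq0 // addnC; exact: ltn_predn_addn.
Qed.
End BivariatePrimes.

(** * Lifting points along a monic polynomial *)

Section LyingOver.

(* Stated in the library only for morphisms from a polynomial ring. *)
Lemma rmorph_resultant (R S : nzRingType) (f : {rmorphism R -> S}) p q :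
    f (lead_coef p) != 0 -> f (lead_coef q) != 0 ->
  f (resultant p q) = resultant (map_poly f p) (map_poly f q).
Proof.
move=> nz_fp nz_fq; rewrite /resultant /Sylvester_mx !size_map_poly_id0 //.
rewrite -det_map_mx /= map_col_mx; congr (\det (col_mx _ _));
  by apply: map_lin1_mx => v; rewrite map_poly_rV rmorphM /= map_rVpoly.
Qed.

Variables (B : comNzRingType) (k : closedFieldType) (ev : {rmorphism B -> k}).
Hypothesis ev_surj : forall c, exists b, ev b = c.

(* If the specialization of [J] contained a unit, the resultant of a monic
   element of [J] and of a lift of this unit would lie in [J] and in [B]
   without vanishing under [ev].  The lift is made monic first, so that its
   degree does not drop under specialization. *)
Lemma common_root_of_monic (J : set {poly B}) (f : {poly B}) :
    is_ideal J -> J f -> f \is monic -> (forall b, J b%:P -> ev b = 0) ->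
  exists t, forall g, J g -> (map_poly ev g).[t] = 0.
Proof.
move=> IJ Jf mf J0.
pose fe := map_poly ev f.
have mfe : fe \is monic by exact: monic_map.
pose D := [set g | exists2 h, J h & g = map_poly ev h].
(* As [ev] is onto, the specializations of [J] form an ideal, generated by [g] of least size. Any
   root of [g] serves as [t]. *)
have [g [[[h Jh Dg] g0] ming]] : exists g, (D g /\ g != 0) /\
    forall q, D q /\ q != 0 -> (size g <= size q)%N.
  apply: (@exists_min_size _ [set q | D q /\ q != 0]).
  by exists fe; split; [exists f | exact: monic_neq0].
have lift (q : {poly k}) : exists r, q = map_poly ev r.
  exists (\poly_(i < size q) sval (cid (ev_surj q`_i))).
  apply/polyP => i; rewrite coef_map coef_poly.
  case: ltnP => [_|lt_i]; first by case: cid.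
  by rewrite nth_default ?raddf0.
have div_g q : J q -> g %| map_poly ev q.
  move=> Jq; rewrite /dvdp; apply: contraT => r0.
  have := ltn_modp (map_poly ev q) g; rewrite g0 ltnNge ming //; split=> //.
  have [r Dr] := lift (map_poly ev q %/ g).
  exists (q - r * h); first by apply: idealB => //; exact: idealMl.
  by apply/eqP; rewrite rmorphB rmorphM /= -Dr -Dg eq_sym subr_eq addrC -divp_eq.
have [g1|g1] := eqVneq (size g) 1%N; last first.
  have /closed_rootP[t /rootP gt] := g1.
  exists t => q /div_g/dvdpP[r ->]; by rewrite hornerM gt mulr0.
have /size_poly1P[c c0 Dc] : size g == 1%N by rewrite g1.
have [n le_hn] : exists n, (size h < n)%N by exists (size h).+1.
exfalso.
have [f1|f1] := leqP (size f) 1.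
  have Df : f = 1.
    have Df := size1_polyC f1.
    by move: mf; rewrite Df monicE lead_coefC => /eqP->.
  have : ev 1 = 0 by apply: J0; rewrite polyC1 -Df.
  by move/eqP; rewrite rmorph1 oner_eq0.
pose h' := h + 'X^n * f.
have sXf : size ('X^n * f) = (n + size f)%N.
  by rewrite size_Mmonic ?monic_neq0 ?monicXn // size_polyXn addSn.
have lt_h : (size h < size ('X^n * f)%R)%N by rewrite sXf ltn_addr.
have mh' : h' \is monic.
  by rewrite monicE /h' lead_coefDr // lead_coef_Mmonic // lead_coefXn.
have sh' : (1 < size h')%N.
  by rewrite /h' addrC size_polyDl // sXf (leq_trans f1) ?leq_addl.
have [[u v] /= _ Dr] := resultant_in_ideal f1 sh'.
have Jh' : J h' by apply: idealD => //; exact: idealMl.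
have : ev (resultant f h') = 0.
  by apply: J0; rewrite Dr; apply: idealD => //; exact: idealMl.
rewrite rmorph_resultant ?(eqP mf) ?(eqP mh') ?rmorph1 ?oner_neq0 //.
apply/eqP; rewrite resultant_eq0 -leqNgt.
rewrite /h' rmorphD rmorphM /= -Dg Dc map_polyXn -/fe.
(* Modulo [fe] the second polynomial is the nonzero constant [c], so the two are coprime. *)
rewrite addrC (eqp_size (gcdp_addl_mul _ _ _)).
rewrite (leq_trans (dvdp_leq _ (dvdp_gcdr _ _))) ?size_polyC_leq1 //.
by rewrite polyC_eq0.
Qed.
End LyingOver.

Lemma monic_mul_small (B : idomainType) (h u : {poly B}) : h \is monic ->
  (size (h * u)%R < size h)%N -> u = 0.
Proof.
move=> mh; apply: contraTeq => u0; rewrite -leqNgt size_monicM //.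
by rewrite (polySpred u0) addnS leq_addr.
Qed.

(* Dividing by monic polynomials shows that [h1, h2, h3] is a regular sequence
   if [h1] is a nonzero constant and [h2], [h3] are monic in the inner and in
   the outer variable; the next two lemmas are its two nontrivial steps. *)
Lemma regular_sequence2 (C : idomainType) (h1 : C) (h2 : {poly C})
    (p q : {poly {poly C}}) :
    h2 \is monic -> h2%:P * q = h1%:P%:P * p ->
  exists a, q = h1%:P%:P * a.
Proof.
move=> m2 Dq.
(* The candidate is the quotient of [a] by [h2]: the error, multiplied by [h2], equals [h1] times
   the remainder and is too short unless it vanishes. *)
have quo (a b : {poly C}) : h2 * b = h1%:P * a -> {c | b = h1%:P * c}.
  move=> Db; exists (a %/ h2); apply/eqP; rewrite -subr_eq0; apply/eqP.
  apply: (monic_mul_small m2).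
  have -> : h2 * (b - h1%:P * (a %/ h2)) = h1 *: (a %% h2).
    rewrite mulrBr Db {1}(Pdiv.IdomainMonic.divp_eq m2 a) mulrDr -mul_polyC.
    by rewrite [h2 * _]mulrC -mulrA addrAC subrr add0r.
  by rewrite (leq_ltn_trans (size_scale_leq _ _)) // ltn_modpN0 // monic_neq0.
have Dqi i : h2 * q`_i = h1%:P * p`_i by rewrite -!coefCM Dq.
exists (\poly_(i < size q) sval (quo _ _ (Dqi i))).
apply/polyP => i; rewrite coefCM coef_poly.
case: ltnP => [_|lt_i]; first by case: quo.
by rewrite mulr0 nth_default.
Qed.

Lemma regular_sequence3 (B : idomainType) (h1 h2 : B) (h3 u a b : {poly B}) :
    h3 \is monic -> h3 * u = h1%:P * a + h2%:P * b ->
  exists a' b', u = h1%:P * a' + h2%:P * b'.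
Proof.
move=> m3 Du; exists (a %/ h3), (b %/ h3); apply/eqP; rewrite -subr_eq0; apply/eqP.
apply: (monic_mul_small m3).
have -> : h3 * (u - (h1%:P * (a %/ h3) + h2%:P * (b %/ h3))) =
    h1 *: (a %% h3) + h2 *: (b %% h3).
  rewrite mulrBr Du {1}(Pdiv.IdomainMonic.divp_eq m3 a).
  rewrite {1}(Pdiv.IdomainMonic.divp_eq m3 b) !mulrDr -!mul_polyC.
  rewrite ![h3 * _]mulrC -!mulrA; apply/eqP.
  by rewrite subr_eq [eqbRHS]addrC [eqbRHS]addrACA.
have ltm c : (size (c %% h3)%R < size h3)%N by rewrite ltn_modpN0 // monic_neq0.
rewrite (leq_ltn_trans (size_polyD _ _)) // gtn_max.
by rewrite !(leq_ltn_trans (size_scale_leq _ _)).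
Qed.

(** * Shears and Noether normalization *)

Section PolynomialEval.
Variable k : closedFieldType.

Lemma poly_horner_eq0 (p : {poly k}) : (forall x, p.[x] = 0) -> p = 0.
Proof.
move=> p0; apply/eqP; apply: contraT => nz.
(* If [p] is nonzero, this polynomial is not constant, yet its only value is 1. *)
have [|x] := @closed_rootP k (p * 'X + 1) _.
  rewrite size_polyDl size_mulX ?size_poly1 // ?ltnS ?size_poly_gt0 //.
  by rewrite eqSS size_poly_eq0.
by rewrite /root !hornerE p0 mul0r add0r oner_eq0.
Qed.

(** The point comes first so that evaluation can carry a ring morphism structure. *)
Definition evalp n (v : 'cV[k]_n) (p : {mpoly k[n]}) : k := peval p v.

HB.instance Definition _ n (v : 'cV[k]_n) :=
  GRing.RMorphism.copy (evalp v) (meval (fun i => v i 0)).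

Lemma evalp_mmap (n : nat) (R : comNzRingType) (f : {rmorphism k -> R})
    (h : 'I_n -> R) (g : {rmorphism R -> k}) p (v : 'cV[k]_n) :
    (forall c, g (f c) = c) -> (forall i, g (h i) = v i 0) ->
  g (mmap f h p) = evalp v p.
Proof.
move=> gf gh; rewrite /evalp /peval mevalE /mmap rmorph_sum; apply: eq_bigr => m _.
rewrite rmorphM /= gf /mmap1 rmorph_prod; congr (_ * _); apply: eq_bigr => i _.
by rewrite rmorphXn /= gh.
Qed.

Definition evalp2 n (c : 'cV[k]_n) x (q : {poly {mpoly k[n]}}) : k :=
  (map_poly (evalp c) q).[x].

HB.instance Definition _ n (c : 'cV[k]_n) x :=
  GRing.RMorphism.copy (evalp2 c x)
    (horner_eval x \o map_poly (evalp c)).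

Lemma evalp2C n (p : {mpoly k[n]}) c x : evalp2 c x p%:P = evalp c p.
Proof. by rewrite /evalp2 map_polyC hornerC. Qed.

Lemma evalp2X n (c : 'cV[k]_n) x : evalp2 c x 'X = x.
Proof. by rewrite /evalp2 map_polyX hornerX. Qed.

Lemma evalpC n c (v : 'cV[k]_n) : evalp v c%:MP = c.
Proof. exact: mevalC. Qed.

Lemma evalpX n i (v : 'cV[k]_n) : evalp v 'X_i = v i 0.
Proof. exact: mevalXU. Qed.
End PolynomialEval.

Section Shear.
Variables (k : closedFieldType) (n : nat) (a : 'cV[k]_n).

(* The polynomial ring in [n.+1] variables as a univariate polynomial ring in
   the last variable, after the shear [X_j |-> X_j + a_j X_n]. *)
Definition shear_var (i : 'I_n.+1) : {poly {mpoly k[n]}} :=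
  if unlift ord_max i is Some j then ('X_j)%:P + (a j 0)%:MP%:P * 'X else 'X.

Definition shear : {mpoly k[n.+1]} -> {poly {mpoly k[n]}} :=
  mmap (polyC \o @mpolyC n k) shear_var.

HB.instance Definition _ := GRing.RMorphism.on shear.

(** The map on points dual to [shear], see [evalp2_shear]. *)
Definition shear_pt (c : 'cV[k]_n) (x : k) : 'cV[k]_n.+1 :=
  \col_i (if unlift ord_max i is Some j then c j 0 + a j 0 * x else x).

Definition unshear_coef : {mpoly k[n]} -> {mpoly k[n.+1]} :=
  mmap (@mpolyC n.+1 k)
    (fun j => 'X_(lift ord_max j) - (a j 0)%:MP * 'X_ord_max).

HB.instance Definition _ := GRing.RMorphism.on unshear_coef.

Definition unshear (p : {poly {mpoly k[n]}}) : {mpoly k[n.+1]} :=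
  (map_poly unshear_coef p).['X_ord_max].

Lemma shear_ptP v : exists c x, v = shear_pt c x.
Proof.
exists (\col_j (v (lift ord_max j) 0 - a j 0 * v ord_max 0)), (v ord_max 0).
apply/colP => i; rewrite mxE; case: unliftP => [j|] -> //.
by rewrite mxE subrK.
Qed.

Lemma evalp2_shear p c x : evalp2 c x (shear p) = evalp (shear_pt c x) p.
Proof.
pose f : {rmorphism k -> {poly {mpoly k[n]}}} := polyC \o @mpolyC n k.
apply: (@evalp_mmap _ _ _ f shear_var (evalp2 c x)) => [b|i] /=.
  by rewrite evalp2C evalpC.
rewrite mxE /shear_var; case: unlift => [j|]; last exact: evalp2X.
by rewrite rmorphD rmorphM /= !evalp2C evalpC evalpX evalp2X.
Qed.

Lemma evalp_unshear q c x : evalp (shear_pt c x) (unshear q) = evalp2 c x q.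
Proof.
rewrite /unshear -(horner_map (evalp (shear_pt c x))) /=.
rewrite -map_poly_comp /= evalpX mxE unlift_none.
congr (_.[_]); apply: eq_map_poly => p /=.
apply: (@evalp_mmap _ _ _ (@mpolyC n.+1 k) _ (evalp (shear_pt c x))) => [b|j] /=.
  by rewrite evalpC.
by rewrite rmorphB rmorphM /= !evalpX evalpC !mxE liftK unlift_none addrK.
Qed.
End Shear.

Section ShearIso.
Variable k : closedFieldType.

(** For [a = 0] the shear only groups monomials by their last exponent. This drives the induction on
    the number of variables in [evalp_eq0]. *)
Lemma coef_shear0 n (p : {mpoly k[n.+1]}) (m : 'X_{1..n.+1}) :
  (shear 0 p)`_(m ord_max)@_[multinom m (lift ord_max j) | j < n] = p@_m.
Proof.
pose rst (m : 'X_{1..n.+1}) := [multinom m (lift ord_max j) | j < n].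
have mmap1E m' : mmap1 (shear_var 0) m' = ('X_[rst m'])%:P * 'X^(m' ord_max).
  rewrite /mmap1 (bigD1_ord ord_max) //= /shear_var unlift_none mulrC.
  congr (_ * _); rewrite mpolyXE_id rmorph_prod; apply: eq_bigr => j _ /=.
  by rewrite liftK mxE mpolyC0 mul0r addr0 mnmE rmorphXn.
have coefE m' : ((p@_m')%:MP%:P * mmap1 (shear_var 0) m')`_(m ord_max)@_(rst m)
    = p@_m' * (m' == m)%:R.
  rewrite mmap1E mulrA -polyCM coefCM coefXn.
  case: (m' =P m) => [->|ne]; first by rewrite eqxx mulr1 mcoeffCM mcoeffX eqxx.
  case: eqP => [Emax|_]; last by rewrite !mulr0 mcoeff0.
  rewrite !mulr1 mcoeffCM mcoeffX; case: eqP => // /mnmP Er; case: ne.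
  apply/mnmP => i; case: (unliftP ord_max i) => [j|] -> //.
  by have := Er j; rewrite !mnmE.
rewrite /shear /mmap coef_sum (raddf_sum (mcoeff (rst m))) /=.
rewrite (eq_bigr _ (fun m' _ => coefE m')).
have [pm|pm] := boolP (m \in msupp p).
  rewrite (bigD1_seq m) ?msupp_uniq //= eqxx mulr1 big1 ?addr0 // => m' ne.
  by rewrite (negbTE ne) mulr0.
rewrite (memN_msupp_eq0 pm) big1_seq // => m' /= m'p.
case: eqP => [E|]; last by rewrite mulr0.
by rewrite -E m'p in pm.
Qed.

Lemma evalp_eq0 n (p : {mpoly k[n]}) : (forall v, evalp v p = 0) -> p = 0.
Proof.
elim: n p => [|n IHn] p p0.
  by have := p0 0; rewrite [p]nvar0_mpolyC evalpC => ->.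
apply/mpolyP => m; rewrite mcoeff0 -coef_shear0.
rewrite (_ : (shear 0 p)`_(m ord_max) = 0) ?mcoeff0 //; apply: IHn => c.
rewrite -(coef_map (evalp c)) /=.
rewrite (_ : map_poly _ _ = 0) ?coef0 //; apply: poly_horner_eq0 => x.
exact: etrans (evalp2_shear _ _ _ _) _.
Qed.

Lemma evalp_inj n (p q : {mpoly k[n]}) :
  (forall v, evalp v p = evalp v q) -> p = q.
Proof.
move=> pq; apply/eqP; rewrite -subr_eq0; apply/eqP/evalp_eq0 => v.
by rewrite rmorphB /= pq subrr.
Qed.

Lemma evalp2_inj n (p q : {poly {mpoly k[n]}}) :
  (forall c x, evalp2 c x p = evalp2 c x q) -> p = q.
Proof.
move=> pq; apply/polyP => i; apply: evalp_inj => c.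
rewrite -!(coef_map (evalp c)) /=.
suff -> : map_poly (evalp c) p = map_poly (evalp c) q by [].
apply/eqP; rewrite -subr_eq0; apply/eqP/poly_horner_eq0 => x.
by have := pq c x; rewrite /evalp2 hornerD hornerN => ->; rewrite subrr.
Qed.

Lemma shearK n (a : 'cV[k]_n) : cancel (shear a) (unshear a).
Proof.
move=> p; apply: evalp_inj => v; have [c [x ->]] := shear_ptP a v.
by rewrite evalp_unshear evalp2_shear.
Qed.

Lemma unshearK n (a : 'cV[k]_n) : cancel (unshear a) (shear a).
Proof.
by move=> q; apply: evalp2_inj => c x; rewrite evalp2_shear evalp_unshear.
Qed.

End ShearIso.

(** * Making a polynomial monic by a shear *)

Section MonicNormalization.
Variable k : closedFieldType.

Lemma exists_evalp_neq0 n (p : {mpoly k[n]}) : p != 0 ->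
  exists v, evalp v p != 0.
Proof.
move=> nz; apply: contrapT => nex; move/eqP: nz; apply; apply: evalp_eq0 => v.
by apply/eqP; apply: contra_notT nex => ?; exists v.
Qed.

Let top n (d : nat) (q : {poly {mpoly k[n]}}) (c : k) :=
  (size q <= d.+1)%N /\ q`_d = c%:MP.

Let topM n d e (p q : {poly {mpoly k[n]}}) b c :
  top d p b -> top e q c -> top (d + e) (p * q) (b * c).
Proof.
move=> [sp pd] [sq qe]; split.
  rewrite (leq_trans (size_polyMleq _ _)) // -subn1 leq_subLR add1n.
  by rewrite -addSn -addnS leq_add.
have ltd : (d < (d + e).+1)%N by rewrite ltnS leq_addr.
rewrite coefM (bigD1 (Ordinal ltd)) //= addKn pd qe big1 ?addr0 ?mpolyCM //.
move=> i; rewrite -val_eqE neq_ltn /= => /orP[lt_id|lt_di].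
  rewrite [q`__]nth_default ?mulr0 // (leq_trans sq) // ltn_subRL.
  by rewrite ltn_add2r.
by rewrite [p`__]nth_default ?mul0r // (leq_trans sp).
Qed.

Let topX n (p : {poly {mpoly k[n]}}) c e : top 1 p c -> top e (p ^+ e) (c ^+ e).
Proof.
move=> t1; elim: e => [|e IHe].
  by rewrite !expr0; split; rewrite ?size_poly1 // coef1 mpolyC1.
by rewrite !exprS -add1n; exact: topM.
Qed.

Let top_shear_var n (a : 'cV[k]_n) i :
  top 1 (shear_var a i) (shear_pt a 0 1 i 0).
Proof.
rewrite /shear_var mxE; case: unlift => [j|]; last first.
  by split; rewrite ?size_polyX // coefX mpolyC1.
rewrite mxE mulr1 add0r; split; last by rewrite coefD coefC coefCM coefX add0r mulr1.
rewrite (leq_trans (size_polyD _ _)) // geq_max.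
rewrite (leq_trans (size_polyC_leq1 _)) //.
by rewrite mul_polyC (leq_trans (size_scale_leq _ _)) ?size_polyX.
Qed.

Let top_mmap1 n (a : 'cV[k]_n) (m : 'X_{1..n.+1}) :
  top (mdeg m) (mmap1 (shear_var a) m) (\prod_i shear_pt a 0 1 i 0 ^+ m i).
Proof.
rewrite mdegE /mmap1; elim/big_ind3: _ => [|? ? ? ? ? ? ? ?|i _].
- by split; rewrite ?size_poly1 // coef1 mpolyC1.
- exact: topM.
- exact/topX/top_shear_var.
Qed.

(** With [d] the total degree of [f], the coefficient of degree [d] in [shear a f] is the scalar
    [ft(a, 1)], where [ft] is the top homogeneous part. So [a] is chosen with [ft(a, 1)] nonzero and
    [c] is its inverse. *)
Lemma exists_shear_monic n (f : {mpoly k[n.+1]}) : f != 0 ->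
  exists (a : 'cV[k]_n) (c : k), shear a (c%:MP * f) \is monic.
Proof.
move=> f0; pose d := (msize f).-1.
have Ed : msize f = d.+1 by rewrite prednK // lt0n msize_poly_eq0.
pose ft := \sum_(m <- msupp f | mdeg m == d) f@_m *: 'X_[m].
have ft0 : ft != 0.
  rewrite /ft -big_filter -msupp_eq0.
  have /perm_mem/(_ (mlead f)) : perm_eq (msupp (\sum_(m <- [seq m <- msupp f |
      mdeg m == d]) f@_m *: 'X_[m])) [seq m <- msupp f | mdeg m == d].
    apply: msupp_sumX; first by rewrite filter_uniq ?msupp_uniq.
    by move=> m; rewrite mem_filter mcoeff_msupp => /andP[].
  rewrite mem_filter mlead_supp // -eqSS mlead_deg // Ed eqxx.
  by case: msupp.
have evalft (u : 'I_n.+1 -> k) : ft.@[u] =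
    \sum_(m <- msupp f | mdeg m == d) f@_m * \prod_i u i ^+ m i.
  by rewrite raddf_sum; apply: eq_bigr => m _; rewrite /= mevalZ mevalX.
(* The extra factor keeps the last coordinate of [v] nonzero; by homogeneity [v] can then be
   rescaled to last coordinate 1. *)
have [v] : exists v, evalp v ('X_ord_max * ft) != 0.
  by apply: exists_evalp_neq0; rewrite mulf_neq0 // -msupp_eq0 msuppX.
rewrite rmorphM /= evalpX mulf_eq0 => /norP[vmax ftv].
pose u i := v i 0 / v ord_max 0.
have ft1 : ft.@[u] != 0.
  apply: contraNneq ftv => ftu0.
  rewrite -(mulr0 (v ord_max 0 ^+ d)) -ftu0 /evalp /peval !evalft mulr_sumr.
  apply/eqP/eq_bigr => m /eqP <-; rewrite mulrCA mdegE; congr (_ * _).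
  rewrite -prodrXr -big_split; apply: eq_bigr => i _ /=.
  by rewrite -exprMn mulrC divfK.
pose a := \col_j u (lift ord_max j).
have Ea i : shear_pt a 0 1 i 0 = u i.
  rewrite mxE; case: (unliftP ord_max i) => [j|] ->; last by rewrite /u divff.
  by rewrite !mxE add0r mulr1.
have topf : top d (shear a f) ft.@[u].
  have topm m := top_mmap1 a m.
  rewrite /shear /mmap; split.
    rewrite (leq_trans (size_sum _ _ _)) //; apply/bigmax_leqP_seq => m fm _ /=.
    rewrite mul_polyC (leq_trans (size_scale_leq _ _)) //.
    by case: (topm m) => /leq_trans + _; apply; rewrite -Ed msize_mdeg_lt.
  rewrite coef_sum evalft raddf_sum (bigID (fun m => mdeg m == d)) /=.
  rewrite [X in _ + X]big1_seq ?addr0 => [|m /andP[ne fm]].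
    apply: eq_bigr => m /eqP Em; case: (topm m); rewrite Em => _.
    rewrite coefCM => ->; rewrite mpolyCM; congr (_ * _%:MP).
    by apply: eq_bigr => i _; rewrite Ea.
  rewrite coefCM nth_default ?mulr0 //; case: (topm m) => /leq_trans + _; apply.
  by rewrite ltn_neqAle ne -ltnS -Ed msize_mdeg_lt.
exists a, (ft.@[u])^-1.
case: topf => sf cf.
have Ef : shear a ((ft.@[u])^-1%:MP * f) = (ft.@[u])^-1%:MP%:P * shear a f.
  by rewrite rmorphM /=; congr (_ * _); rewrite /shear mmapC.
have cd : (shear a ((ft.@[u])^-1%:MP * f))`_d = 1.
  by rewrite Ef coefCM cf -mpolyCM mulVf // mpolyC1.
have sd : size (shear a ((ft.@[u])^-1%:MP * f)) = d.+1.
  apply/eqP; rewrite eqn_leq; apply/andP; split.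
    by rewrite Ef mul_polyC (leq_trans (size_scale_leq _ _)).
  rewrite ltnNge; apply/negP => /leq_sizeP/(_ d (leqnn d))/eqP.
  by rewrite cd oner_eq0.
by rewrite monicE /lead_coef sd cd.
Qed.
End MonicNormalization.

(** * Zero sets and vanishing ideals *)

Section ZeroLoci.
Variables (k : closedFieldType) (n : nat).
Implicit Types (P I : set {mpoly k[n]}) (Y Z : set 'cV[k]_n).

Definition zeros I : set 'cV[k]_n := [set v | forall p, I p -> peval p v = 0].

Definition vanishing Y : set {mpoly k[n]} :=
  [set p | forall v, Y v -> peval p v = 0].

Lemma vanishing_ideal Y : is_ideal (vanishing Y).
Proof.
split=> [v _|p q Yp Yq v Yv|a p Yp v Yv]; rewrite -/(evalp v _).
- exact: rmorph0.
- by rewrite rmorphD /= /evalp Yp // Yq // addr0.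
- by rewrite rmorphM /= /evalp Yp // mulr0.
Qed.

Lemma zeros_closed I : zclosed (zeros I).
Proof. by exists I. Qed.

Lemma zeros_vanishing Y : zclosed Y -> zeros (vanishing Y) = Y.
Proof.
move=> [I ->]; apply/seteqP; split=> v Yv p Ip; last exact: Ip.
by apply: Yv => w; exact.
Qed.

Lemma vanishing_prime Y : irreducible_closed Y -> is_prime (vanishing Y).
Proof.
move=> [clY [v0 Yv0] irrY]; split; first exact: vanishing_ideal.
  by move=> /(_ _ Yv0)/eqP; rewrite -/(evalp v0 _) rmorph1 oner_eq0.
move=> p q Ypq.
have Y1 (r : {mpoly k[n]}) : Y `<=` zeros [set r] -> vanishing Y r.
  by move=> Yr v /Yr; exact.
have [||v Yv|/Y1|/Y1] := irrY (zeros [set p]) (zeros [set q]);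
  [exact: zeros_closed|exact: zeros_closed| |by left|by right].
have /eqP := Ypq _ Yv; rewrite -/(evalp v _) rmorphM mulf_eq0 /=.
by case/orP => /eqP v0'; [left|right] => r ->.
Qed.

Lemma zeros_irreducible P : is_prime P -> vanishing (zeros P) `<=` P ->
  irreducible_closed (zeros P).
Proof.
move=> [_ P1 PM] vP; split; first exact: zeros_closed.
  apply/set0P/eqP => zP0; apply/P1/vP => v; by rewrite zP0.
move=> A B [IA ->] [IB ->] PAB.
have [|/existsNP[v /not_implyP[Pv /existsNP[p /not_implyP[Ap pv]]]]] :=
  pselect (zeros P `<=` [set v | forall p, IA p -> peval p v = 0]); first by left.
have [|/existsNP[w /not_implyP[Pw /existsNP[q /not_implyP[Bq qw]]]]] :=
  pselect (zeros P `<=` [set v | forall p, IB p -> peval p v = 0]); first by right.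
exfalso; have /PM[Pp|Pq] : P (p * q); last 2 first.
- by apply: pv; exact: Pv.
- by apply: qw; exact: Pw.
apply: vP => u /PAB uAB; rewrite -/(evalp u _) rmorphM /= /evalp.
by case: uAB => [/(_ _ Ap)->|/(_ _ Bq)->]; rewrite ?mul0r ?mulr0.
Qed.

(** Vanishing ideals reverse the chain of closed sets, and keep it strict because a closed set is
    the zero set of its vanishing ideal. *)
Lemma codim_prime_chain c Z P : codim_geq c Z -> is_prime P ->
    vanishing (zeros P) `<=` P -> zeros P `<=` Z ->
  exists Q : nat -> set {mpoly k[n]},
    [/\ Q 0%N = P, forall i, (i <= c)%N -> is_prime (Q i) &
        forall i, (i < c)%N -> Q i.+1 `<=` Q i /\ ~ (Q i `<=` Q i.+1)].
Proof.
move=> cZ prP vP PZ.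
have [l [C [le_cl C0 irrC ltC]]] := cZ _ (zeros_irreducible prP vP) PZ.
exists (vanishing \o C); split=> [|i le_ic|i lt_ic] /=.
- rewrite C0; apply/seteqP; split=> // p Pp v; exact.
- by apply/vanishing_prime/irrC/(leq_trans le_ic).
have lt_il := leq_trans lt_ic le_cl; have [CC nCC] := ltC i lt_il.
split; first by move=> p Cp v /CC; exact: Cp.
move=> vC; apply: nCC.
rewrite -(zeros_vanishing (Y := C i)); last by case: (irrC i (ltnW lt_il)).
by move=> v Cv p /vC; exact.
Qed.

(* This replaces the Nullstellensatz and the decomposition into irreducible
   components: [P] is maximal among the ideals avoiding [S], so it is the ideal
   of its zeros once that larger ideal also avoids [S]. *)
Lemma exists_vanishing_prime (I S : set {mpoly k[n]}) : is_ideal I -> S 1 ->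
    (forall x y, S x -> S y -> S (x * y)) -> I `&` S = set0 ->
    (forall J, is_ideal J -> I `<=` J -> J `&` S = set0 ->
      forall s, S s -> exists2 v, zeros J v & peval s v != 0) ->
  exists P, [/\ is_prime P, I `<=` P, P `&` S = set0 &
    vanishing (zeros P) `<=` P].
Proof.
move=> II S1 SM IS0 dom.
have [P [IP IsP PS0 maxP]] := maximal_ideal_disjoint II IS0.
exists P; split=> //; first exact: (prime_of_maximal_disjoint IP PS0).
apply: maxP; first exact: vanishing_ideal.
  by move=> p Pp v; exact.
apply/seteqP; split=> // s [vs Ss].
by have [v /vs->] := dom P IP IsP PS0 s Ss; rewrite eqxx.
Qed.

(** A regular sequence whose quotient ring may be zero: [1, 1, 1] is allowed, which covers ideals
    containing 1. *)
Definition regular_triple (h1 h2 h3 : {mpoly k[n]}) : Prop :=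
  [/\ h1 != 0, forall p q, h2 * q = h1 * p -> exists a, q = h1 * a &
      forall u a b, h3 * u = h1 * a + h2 * b ->
        exists a' b', u = h1 * a' + h2 * b'].
End ZeroLoci.

HB.instance Definition _ (k : closedFieldType) n (a : 'cV[k]_n) :=
  GRing.RMorphism.copy (unshear a)
    (horner_eval 'X_ord_max \o map_poly (unshear_coef a)).

Lemma regular_triple_iso n (k : closedFieldType) (C : idomainType)
    (sigma : {rmorphism {mpoly k[n]} -> {poly {poly C}}})
    (tau : {rmorphism {poly {poly C}} -> {mpoly k[n]}})
    (c : C) (g : {poly C}) (f : {poly {poly C}}) h1 h2 h3 :
    cancel sigma tau -> c != 0 -> g \is monic -> f \is monic ->
    sigma h1 = c%:P%:P -> sigma h2 = g%:P -> sigma h3 = f ->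
  regular_triple h1 h2 h3.
Proof.
move=> sigmaK c0 mg mf sh1 sh2 sh3; split=> [|p q|u p q].
- apply: contraNneq c0 => /(congr1 sigma)/eqP.
  by rewrite sh1 rmorph0 !polyC_eq0.
- move=> /(congr1 sigma); rewrite !rmorphM sh1 sh2.
  move=> /(regular_sequence2 mg)[e /(congr1 tau)].
  by rewrite sigmaK rmorphM -sh1 sigmaK; exists (tau e).
- move=> /(congr1 sigma); rewrite rmorphD !rmorphM sh1 sh2 sh3.
  move=> /(regular_sequence3 mf)[p' [q' /(congr1 tau)]].
  rewrite sigmaK rmorphD !rmorphM -sh1 -sh2 !sigmaK.
  by exists (tau p'), (tau q').
Qed.

Section NoetherNormalization.
Variable k : closedFieldType.

(** Because [f] is monic in the last variable, the projection of the zeros of [J] is onto the zeros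
    of the contraction. *)
Lemma lift_zero n (a c : 'cV[k]_n) (J : set {mpoly k[n.+1]}) f :
    is_ideal J -> J f -> shear a f \is monic ->
    (forall b, J (unshear a b%:P) -> evalp c b = 0) ->
  exists t, zeros J (shear_pt a c t).
Proof.
move=> IJ Jf mf J0.
have [|||t tP] := @common_root_of_monic _ k (evalp c) _ (unshear a @^-1` J)
  (shear a f) _ _ mf J0.
- by move=> x; exists x%:MP; exact: evalpC.
- exact: preim_ideal.
- by rewrite /preimage /= shearK.
exists t => p Jp; rewrite -/(evalp _ _) -evalp2_shear; apply: tP.
by rewrite /preimage /= shearK.
Qed.

(** Otherwise some prime over [I] contracts to 0, and codimension 2 gives [Q 0 > Q 1 > Q 2]. Here
    [Q 0] and [Q 1] contract to 0 and [Q 2] shows that [Q 1] is nonzero, against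
    [prime_sub_of_neq0]. *)
Lemma contraction_neq0 n (a : 'cV[k]_n) (I : set {mpoly k[n.+1]}) Z f :
    is_ideal I -> zeros I `<=` Z -> codim_geq 2 Z -> I f ->
    shear a f \is monic ->
  exists2 b, I (unshear a b%:P) & b != 0.
Proof.
move=> II IZ cZ If mf; apply: contrapT => nb.
have I0 b : I (unshear a b%:P) -> b = 0.
  by move=> Ib; apply/eqP; apply: contra_notT nb; exists b.
pose S := [set p | exists2 b, p = unshear a b%:P & b != 0].
have S0 J : J `&` S = set0 -> forall b, J (unshear a b%:P) -> b = 0.
  move=> JS b Jb; apply/eqP; apply: contraT => b0.
  suff : (J `&` S) (unshear a b%:P) by rewrite JS.
  by split=> //; exists b.
have [||||P [prP IP PS vP]] := @exists_vanishing_prime k n.+1 I S II.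
- by exists 1; rewrite ?oner_neq0 // polyC1 rmorph1.
- move=> _ _ [b -> b0] [c -> c0]; exists (b * c); last by rewrite mulf_neq0.
  by rewrite polyCM rmorphM.
- apply/seteqP; split=> // p [Ip [b Db b0]]; move: Ip b0.
  by rewrite Db => /I0->; rewrite eqxx.
(* As [J] contracts to 0, every point [c] of the base lifts to a zero of [J], in particular one
   where [b] does not vanish. *)
- move=> J IJ IsJ /S0 J0 _ [b -> /exists_evalp_neq0[c bc]].
  have [||t Jt] := lift_zero (a := a) (c := c) IJ _ mf.
  + exact: IsJ.
  + by move=> b' /J0->; rewrite rmorph0.
  + by exists (shear_pt a c t) => //; rewrite -/(evalp _ _) evalp_unshear evalp2C.
have [|Q [Q0 prQ ltQ]] := codim_prime_chain cZ prP vP.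
  by apply: subset_trans IZ => v Pv p /IP; exact: Pv.
have [[Q10 nQ01] [Q21 nQ12]] := (ltQ 0 isT, ltQ 1 isT).
apply: nQ01 => p Q0p; rewrite -[p](shearK a).
apply: (@prime_sub_of_neq0 _ (unshear a @^-1` Q 0%N) (unshear a @^-1` Q 1%N)).
- exact/preim_prime/prQ.
- exact/preim_prime/prQ.
- by move=> q; exact: Q10.
- by rewrite Q0; exact: S0.
- have /existsNP[q /not_implyP[Q1q nQ2q]] := nQ12.
  exists (shear a q); first by rewrite /preimage /= shearK.
  apply: contra_not_neq nQ2q => q0; rewrite -[q](shearK a) q0 rmorph0.
  by case: (prQ 2) => // -[].
- by rewrite /preimage /= shearK.
Qed.

(** The two-variable analogue: points are lifted twice, and [Q 0 > Q 1 > Q 2] contradicts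
    [no_prime_chain3], with [Q 3] ensuring that [Q 2] is nonzero. *)
Lemma contraction2_neq0 n (a : 'cV[k]_n.+1) (b : 'cV[k]_n)
    (I : set {mpoly k[n.+2]}) Z f g :
    is_ideal I -> zeros I `<=` Z -> codim_geq 3 Z -> I f ->
    shear a f \is monic -> I (unshear a g%:P) -> shear b g \is monic ->
  exists2 c, I (unshear a (unshear b c%:P)%:P) & c != 0.
Proof.
move=> II IZ cZ If mf Ig mg; apply: contrapT => nc.
pose iota c := unshear a (unshear b c%:P)%:P.
have I0 c : I (iota c) -> c = 0.
  by move=> Ic; apply/eqP; apply: contra_notT nc; exists c.
pose S := [set p | exists2 c, p = iota c & c != 0].
have S0 J : J `&` S = set0 -> forall c, J (iota c) -> c = 0.
  move=> JS c Jc; apply/eqP; apply: contraT => c0.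
  suff : (J `&` S) (iota c) by rewrite JS.
  by split=> //; exists c.
have [||||P [prP IP PS vP]] := @exists_vanishing_prime k n.+2 I S II.
- by exists 1; rewrite ?oner_neq0 // /iota !(polyC1, rmorph1).
- move=> _ _ [c -> c0] [d -> d0]; exists (c * d); last by rewrite mulf_neq0.
  by rewrite /iota !(polyCM, rmorphM).
- apply/seteqP; split=> // p [Ip [c Dc c0]]; move: Ip c0.
  by rewrite Dc => /I0->; rewrite eqxx.
- move=> J IJ IsJ /S0 J0 _ [c -> /exists_evalp_neq0[e ce]].
  have [|||y Jy] := @lift_zero n b e ((unshear a \o polyC) @^-1` J) g _ _ mg.
  + exact: (preim_ideal (unshear a \o polyC)).
  + exact: IsJ.
  + by move=> d /J0->; rewrite rmorph0.
  have [||t Jt] := lift_zero (a := a) (c := shear_pt b e y) IJ _ mf.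
  + exact: IsJ.
  + by move=> d /Jy.
  exists (shear_pt a (shear_pt b e y) t) => //.
  by rewrite -/(evalp _ _) evalp_unshear evalp2C evalp_unshear evalp2C.
have [|Q [Q0 prQ ltQ]] := codim_prime_chain cZ prP vP.
  by apply: subset_trans IZ => v Pv p /IP; exact: Pv.
pose tau := unshear a \o map_poly (unshear b).
have tauK p : tau (map_poly (shear b) (shear a p)) = p.
  rewrite /tau /= -map_poly_comp map_poly_id ?shearK // => q _ /=.
  exact: shearK.
have prT i : (i <= 3)%N -> is_prime (tau @^-1` Q i).
  by move=> le_i; apply/preim_prime/prQ.
have leT i : (i < 3)%N -> tau @^-1` Q i.+1 `<=` tau @^-1` Q i.
  by move=> /ltQ[QQ _] p; exact: QQ.
have ltT i : (i < 3)%N -> ~ (tau @^-1` Q i `<=` tau @^-1` Q i.+1).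
  move=> /ltQ[_ nQQ] TT; apply: nQQ => p Qp.
  by rewrite -[p]tauK; apply: TT; rewrite /preimage /= tauK.
apply: (no_prime_chain3 (prT 0 isT) (prT 1 isT) (prT 2 isT)).
- exact: leT.
- exact: ltT.
- exact: leT.
- exact: ltT.
- have /existsNP[q /not_implyP[T2q nT3q]] := ltT 2 isT.
  exists q => //; apply: contra_not_neq nT3q => ->.
  by case: (prT 3) => // -[].
- by rewrite Q0 => c; rewrite /preimage /tau /= map_polyC /=; exact: S0.
Qed.

Lemma regular_triple1 n : @regular_triple k n 1 1 1.
Proof.
split=> [|p q _|u a b _]; first exact: oner_neq0.
  by exists q; rewrite mul1r.
by exists u, 0; rewrite mul1r mulr0 addr0.
Qed.

Lemma ideal1_of_const n (I : set {mpoly k[n]}) p c : is_ideal I -> I p ->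
  p = c%:MP -> p != 0 -> I 1.
Proof.
move=> II Ip Dp; move: Ip; rewrite Dp mpolyC_eq0 => Ip c0.
by rewrite -mpolyC1 -(mulVf c0) mpolyCM; exact: idealMl.
Qed.

(* Noether normalization: after two shears, the ideal contains elements that
   are monic in the last two variables, and the codimension forces a nonzero
   element free of both. *)
Lemma exists_regular_triple m (I : set {mpoly k[m]}) Z :
    is_ideal I -> zeros I `<=` Z -> codim_geq 3 Z -> ~ (setT `<=` Z) ->
  exists h1 h2 h3, [/\ I h1, I h2, I h3 & regular_triple h1 h2 h3].
Proof.
move=> II IZ cZ nZ.
have triv1 : I 1 ->
    exists h1 h2 h3, [/\ I h1, I h2, I h3 & regular_triple h1 h2 h3].
  by move=> I1; exists 1, 1, 1; split=> //; exact: regular_triple1.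
have [f If f0] : exists2 f, I f & f != 0.
  apply: contrapT => nf; apply: nZ => v _; apply: IZ => p Ip.
  have -> : p = 0; last exact: (rmorph0 (evalp v)).
  by apply/eqP; apply: contra_notT nf; exists p.
(* When the variables run out, the nonzero element at hand is a constant and the ideal contains
   1. *)
case: m I Z f If f0 II IZ cZ nZ triv1 => [|n] I Z f If f0 II IZ cZ nZ triv1.
  exact/triv1/(ideal1_of_const II If (nvar0_mpolyC f)).
have [a [c mf]] := exists_shear_monic f0.
have {If f0} If : I (c%:MP * f) by exact: idealMl.
move: (_ * f) mf If => {}f mf If.
have cZ2 : codim_geq 2 Z.
  move=> Y irrY YZ; have [l [C [le3 C0 irrC ltC]]] := cZ Y irrY YZ.
  by exists l, C; split=> //; exact: ltnW.
have [g Ig g0] := contraction_neq0 II IZ cZ2 If mf.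
have IIB : is_ideal ((unshear a \o polyC) @^-1` I).
  exact: (preim_ideal (unshear a \o polyC)).
case: n I Z f a II IZ cZ nZ triv1 mf If cZ2 g Ig g0 IIB
  => [|n] I Z f a II IZ cZ nZ triv1 mf If cZ2 g Ig g0 IIB.
  apply: triv1; rewrite -(rmorph1 (unshear a)) -polyC1.
  exact: (ideal1_of_const IIB Ig (nvar0_mpolyC g)).
have [b [d mg]] := exists_shear_monic g0.
have {Ig g0} Ig : ((unshear a \o polyC) @^-1` I) (d%:MP * g).
  exact: (idealMl (I := _ @^-1` _)).
move: (_ * g) mg Ig => {}g mg Ig.
have [h Ih h0] := contraction2_neq0 II IZ cZ If mf Ig mg.
exists (unshear a (unshear b h%:P)%:P), (unshear a g%:P), f.
split; [exact: Ih|exact: Ig|exact: If|].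
apply: (@regular_triple_iso _ k _ (map_poly (shear b) \o shear a)
  (unshear a \o map_poly (unshear b)) h (shear b g)
  (map_poly (shear b) (shear a f))).
- move=> p /=; rewrite -map_poly_comp map_poly_id ?shearK // => q _ /=.
  exact: shearK.
- exact: h0.
- exact: mg.
- exact: monic_map.
- by rewrite /= unshearK map_polyC /= unshearK.
- by rewrite /= unshearK map_polyC.
- by [].
Qed.
End NoetherNormalization.

(** * Polynomial and regular functions *)

Section PolynomialFunctions.
Variables (k : closedFieldType) (n : nat).
Implicit Types f g : 'cV[k]_n -> k.

Definition polyfun f : Prop := exists p : {mpoly k[n]}, forall v, f v = peval p v.

Lemma polyfun_peval (p : {mpoly k[n]}) : polyfun (peval p).
Proof. by exists p. Qed.

Lemma polyfunC c : polyfun (fun=> c).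
Proof. by exists c%:MP => v; rewrite -/(evalp v _) evalpC. Qed.

Lemma polyfun_coord i : polyfun (fun v => v i 0).
Proof. by exists 'X_i => v; rewrite -/(evalp v _) evalpX. Qed.

Lemma polyfunD f g : polyfun f -> polyfun g -> polyfun (fun v => f v + g v).
Proof.
move=> [p fp] [q gq]; exists (p + q) => v.
by rewrite -/(evalp v _) rmorphD /= fp gq.
Qed.

Lemma polyfunM f g : polyfun f -> polyfun g -> polyfun (fun v => f v * g v).
Proof.
move=> [p fp] [q gq]; exists (p * q) => v.
by rewrite -/(evalp v _) rmorphM /= fp gq.
Qed.

Lemma polyfun_sum I (r : seq I) (P : pred I) (F : I -> 'cV[k]_n -> k) :
  (forall i, polyfun (F i)) -> polyfun (fun v => \sum_(i <- r | P i) F i v).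
Proof.
move=> pF; elim: r => [|i r IHr].
  by under eq_fun do rewrite big_nil; exact: polyfunC.
under eq_fun do rewrite big_cons; case: (P i) => //.
exact: polyfunD.
Qed.

Lemma polyfun_prod I (r : seq I) (P : pred I) (F : I -> 'cV[k]_n -> k) :
  (forall i, polyfun (F i)) -> polyfun (fun v => \prod_(i <- r | P i) F i v).
Proof.
move=> pF; elim: r => [|i r IHr].
  by under eq_fun do rewrite big_nil; exact: polyfunC.
under eq_fun do rewrite big_cons; case: (P i) => //.
exact: polyfunM.
Qed.

Lemma polyfun_det m (A : 'cV[k]_n -> 'M[k]_m) :
  (forall i j, polyfun (fun v => A v i j)) -> polyfun (fun v => \det (A v)).
Proof.
move=> pA; rewrite /determinant; apply: polyfun_sum => s.
by apply: polyfunM; [exact: polyfunC|apply: polyfun_prod].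
Qed.

Lemma polyfun_adj m (A : 'cV[k]_n -> 'M[k]_m) i j :
  (forall i j, polyfun (fun v => A v i j)) -> polyfun (fun v => (\adj (A v)) i j).
Proof.
move=> pA; under eq_fun do rewrite mxE /cofactor.
apply: polyfunM; first exact: polyfunC.
by apply: polyfun_det => i' j'; under eq_fun do rewrite !mxE.
Qed.

Lemma polyfun_mulmx m p q (A : 'cV[k]_n -> 'M[k]_(m, p))
    (B : 'cV[k]_n -> 'M[k]_(p, q)) i j :
    (forall i j, polyfun (fun v => A v i j)) ->
    (forall i j, polyfun (fun v => B v i j)) ->
  polyfun (fun v => (A v *m B v) i j).
Proof.
move=> pA pB; under eq_fun do rewrite mxE.
by apply: polyfun_sum => l; exact: polyfunM.
Qed.

Lemma polymapP m (F : 'cV[k]_n -> 'cV[k]_m) :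
  polymap F <-> forall i, polyfun (fun v => F v i 0).
Proof.
split=> [[p Fp] i|pF]; first by exists (p i) => v; exact: Fp.
by exists (fun i => sval (cid (pF i))) => v i; case: cid.
Qed.

(** The products with [h] agree everywhere, and [h] cancels in the domain of polynomials. *)
Lemma polyfun_eq (h : {mpoly k[n]}) f g : h != 0 -> polyfun f -> polyfun g ->
  (forall v, peval h v != 0 -> f v = g v) -> f =1 g.
Proof.
move=> h0 [p fp] [q gq] fg v; rewrite fp gq; congr (peval _ v).
apply: (mulfI h0); apply: evalp_inj => w; rewrite !rmorphM /= /evalp.
by have [->|hw] := eqVneq (peval h w) 0; rewrite ?mul0r // -fp -gq fg.
Qed.

Lemma peval_polymap m (F : 'cV[k]_n -> 'cV[k]_m) (p : {mpoly k[m]}) :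
  polymap F -> polyfun (fun v => peval p (F v)).
Proof.
move=> [q Fq]; exists (p \mPo [tuple q i | i < m]) => v.
rewrite /peval comp_mpoly_meval; apply: meval_eq => i.
by rewrite tnth_mktuple Fq.
Qed.

Lemma zopen_witness (U : set 'cV[k]_n) v : zopen U -> U v ->
  exists2 h : {mpoly k[n]}, peval h v != 0 & forall w, ~ U w -> peval h w = 0.
Proof.
move=> [I DU] Uv; apply: contrapT => nh.
suff : (~` U) v by exact.
rewrite DU => p Ip; apply/eqP; apply: contra_notT nh => pv.
by exists p => // w nUw; have : (~` U) w by []; rewrite DU; exact.
Qed.

Lemma regular_fun_comp m (S : set 'cV[k]_m) (T : set 'cV[k]_n)
    (F : 'cV[k]_n -> 'cV[k]_m) (f : 'cV[k]_m -> k) :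
    polymap F -> (forall v, T v -> S (F v)) -> regular_fun S f ->
  regular_fun T (f \o F).
Proof.
move=> pF TS rf v Tv; have [U [p [q [oU UF fU]]]] := rf _ (TS _ Tv).
have [p' p'E] := peval_polymap p pF; have [q' q'E] := peval_polymap q pF.
exists (F @^-1` U), p', q'; split=> // [|t Tt Ut].
  have [I DU] := oU.
  exists [set r | exists2 s, I s & forall w, peval s (F w) = peval r w].
  rewrite preimage_setC DU; apply/seteqP; split=> w Fw s.
    by move=> [r Ir <-]; exact: Fw.
  by move=> Is; have [r rE] := peval_polymap s pF; rewrite rE; apply: Fw; exists s.
by have [qt ft] := fU _ (TS _ Tt) Ut; rewrite -p'E -q'E.
Qed.

End PolynomialFunctions.

(* The ideal of denominators of [s] has its zeros in [Z], so it contains two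
   coprime elements. *)
Lemma regular_fun_polynomial (k : closedFieldType) n (Z : set 'cV[k]_n)
    (h : {mpoly k[n]}) (s : 'cV[k]_n -> k) :
    codim_geq 3 Z -> h != 0 -> (forall v, peval h v != 0 -> ~ Z v) ->
    regular_fun (~` Z) s ->
  exists p : {mpoly k[n]}, forall v, ~ Z v -> s v = peval p v.
Proof.
move=> cZ h0 hZ rs.
pose num q p := forall v, ~ Z v -> evalp v q * s v = evalp v p.
pose D := [set q | exists p, num q p].
have ID : is_ideal D.
  split=> [|q q' [p Dp] [p' Dp']|a q [p Dp]].
  - by exists 0 => v _; rewrite !rmorph0 mul0r.
  - by exists (p + p') => v Zv; rewrite !rmorphD mulrDl Dp // Dp'.
  - by exists (a * p) => v Zv; rewrite !rmorphM -mulrA Dp.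
have DZ : zeros D `<=` Z.
  move=> v Dv; apply: contrapT => nZv.
  have [U [p [q [oU Uv sU]]]] := rs v nZv.
  have [g gv gU] := zopen_witness oU Uv.
  (* The denominator [q] works only on [U]; multiplied by [g], which vanishes off [U], it works on
     all of the complement of [Z]. *)
  have : peval (q * g) v = 0.
    apply: Dv; exists (p * g) => t nZt; rewrite !rmorphM /=.
    have [Ut|/gU] := pselect (U t); last first.
      by rewrite /evalp => ->; rewrite !mulr0 mul0r.
    have [qt ->] := sU t nZt Ut.
    by rewrite /evalp mulrC mulrA divfK.
  rewrite -/(evalp v _) rmorphM => /eqP; rewrite mulf_eq0 (negbTE gv) orbF.
  by rewrite (negbTE (proj1 (sU v nZv Uv))).
have nZ : ~ (setT `<=` Z).
  by have [v hv] := exists_evalp_neq0 h0; move=> /(_ v I); exact: hZ.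
have [h1 [h2 [h3 [[p1 D1] [p2 D2] _ [h10 reg _]]]]] :=
  exists_regular_triple ID DZ cZ nZ.
have cross q p q' p' : num q p -> num q' p' -> q * p' = q' * p.
  move=> Dq Dq'; apply: (mulfI h0); apply: evalp_inj => v; rewrite !rmorphM /=.
  have [->|/hZ nZv] := eqVneq (evalp v h) 0; first by rewrite !mul0r.
  by rewrite -Dq // -Dq' //; congr (_ * _); exact: mulrCA.
have [a Da] := reg p2 p1 (cross _ _ _ _ D2 D1).
(* Since [h1] may vanish at [v], the value is compared through another denominator. *)
exists a => v nZv; have [q [p Dq] qv] : exists2 q, D q & evalp v q != 0.
  apply: contrapT => nq; apply/nZv/DZ => q Dq.
  by apply/eqP; apply: contra_notT nq => qv; exists q.
apply: (mulfI qv); rewrite Dq // -rmorphM; congr (evalp v _).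
by apply: (mulfI h10); rewrite (cross _ _ _ _ D1 Dq) Da mulrCA.
Qed.

(** * Orbits and stabilizers *)

Section Module.
Variables (k : closedFieldType) (G : affine_alggroup k) (m : nat).
Variable V : rational_module G m.
Notation N := (ag_dim G).
Notation lie := (lie_algebra G).

Lemma lie_act_linear v : linear (fun x => lie_act V x v).
Proof. exact: (lie_act_at_linear V v). Qed.

Lemma lie_actD x y v : lie_act V (x + y) v = lie_act V x v + lie_act V y v.
Proof. by have := lie_act_linear v 1 x y; rewrite !scale1r. Qed.

Lemma lie_act0 v : lie_act V 0 v = 0.
Proof.
by have := lie_act_linear v (-1) 0 0; rewrite !scaleN1r oppr0 addr0 addNr.
Qed.

Lemma lie_actZ c x v : lie_act V (c *: x) v = c *: lie_act V x v.
Proof. by have := lie_act_linear v c x 0; rewrite lie_act0 !addr0. Qed.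

Lemma lie_act_sum r (c : 'I_r -> k) (x : 'I_r -> 'cV[k]_N) v :
  lie_act V (\sum_j c j *: x j) v = \sum_j c j *: lie_act V (x j) v.
Proof.
elim/big_rec2: _ => [|j y z _ <-]; first exact: lie_act0.
by rewrite lie_actD lie_actZ.
Qed.

Lemma polymap_lie_act F : polymap F -> polymap (fun v => lie_act V (F v) v).
Proof.
move=> /polymapP pF; apply/polymapP => i; apply: polyfun_mulmx => [i' j'|i' j'].
  under eq_fun do rewrite mxE; apply: polyfun_sum => l.
  by apply: polyfunM; [exact: pF|exact: polyfunC].
rewrite ord1; exact: polyfun_coord.
Qed.

Lemma lie_algebra_of_dense (h : {mpoly k[m]}) (F : 'cV[k]_m -> 'cV[k]_N) :
    h != 0 -> polymap F -> (forall v, peval h v != 0 -> F v \in lie) ->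
  forall v, F v \in lie.
Proof.
move=> h0 /polymapP pF Fh v; apply/lie_algebraP => p pG.
apply: (polyfun_eq (f := fun v => ddiff p (ag_one G) (F v)) (g := fun=> 0) h0).
- apply: polyfun_sum => l; apply: polyfunM; [exact: pF|exact: polyfunC].
- exact: polyfunC.
- by move=> w /Fh/lie_algebraP; exact.
Qed.

Let orb (w : 'cV[k]_m) : {vspace 'cV[k]_m} :=
  (linfun (lie_act_at V w) @: lie)%VS.

Let orbP w y : lie_orbit V w y <-> y \in orb w.
Proof.
split=> [[x xl <-]|/memv_imgP[x xl ->]].
  by apply/memv_imgP; exists x => //; rewrite lfunE.
by rewrite lfunE; exists x.
Qed.

Let dim_orb w : (\dim (lie_stab V w) + \dim (orb w) = \dim lie)%N.
Proof. exact: limg_ker_dim. Qed.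

Lemma Vreg_nonempty : Vreg V !=set0.
Proof.
pose D n := `[< exists v, \dim (lie_stab V v) = n >].
have exD : exists n, D n.
  by exists (\dim (lie_stab V 0)); apply/asboolP; exists 0.
have [n /asboolP[v <-] minv] := ex_minnP exD.
by exists v => w; apply: minv; apply/asboolP; exists w.
Qed.

(* The [x j] are chosen so that the [x j . v] form a basis of [g.v].  Where
   [det (L T(w))] does not vanish the [x j . w] are free, hence a basis of
   [g.w], whose dimension is at most that of [g.v]. *)
Lemma Vreg_local_basis v : Vreg V v ->
  exists (r : nat) (x : 'I_r -> 'cV[k]_N) (L : 'M[k]_(r, m)),
    let T w := \matrix_(i < m, j < r) lie_act V (x j) w i 0 in
    [/\ forall j, x j \in lie, L *m T v = 1%:M &
        forall w, \det (L *m T w) != 0 -> Vreg V w /\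
          forall y, lie_orbit V w y -> exists z, y = T w *m z].
Proof.
move=> regv; pose r := \dim (orb v); pose b := vbasis (orb v).
have xP (j : 'I_r) : exists x, x \in lie /\ lie_act V x v = b`_j.
  have : b`_j \in orb v by apply/vbasis_mem/mem_nth; rewrite size_tuple.
  by move=> /orbP[x xl <-]; exists x.
pose x j := sval (cid (xP j)).
have xl j : x j \in lie by rewrite /x; case: cid => ? [].
have xv j : lie_act V (x j) v = b`_j by rewrite /x; case: cid => ? [].
(* The rows are the coordinate forms of the basis [b] of [g.v], so [L] is a left inverse of
   [T v]. *)
pose L := \matrix_(i < r, l < m) coord b i (delta_mx l 0).
pose T w := \matrix_(i < m, j < r) lie_act V (x j) w i 0.
have TE w z : T w *m z = \sum_j z j 0 *: lie_act V (x j) w.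
  apply/colP => i; rewrite mxE summxE; apply: eq_bigr => j _.
  by rewrite !mxE mulrC.
exists r, x, L; split=> // [|w].
  apply/matrixP => i j; rewrite !mxE -[RHS](_ : coord b i b`_j = _); last first.
    by rewrite coord_free ?(basis_free (vbasisP _)) // eq_sym.
  rewrite [in RHS](matrix_sum_delta b`_j) exchange_big big_ord1 linear_sum /=.
  apply: eq_bigr => l _; rewrite linearZ /= mulrC.
  by congr (_ * _); [rewrite mxE xv|rewrite mxE].
rewrite -/(T w) => dT.
have LT_unit : L *m T w \in unitmx by rewrite unitmxE unitfE.
pose t := [tuple lie_act V (x j) w | j < r].
have t_nth (j : 'I_r) : t`_j = lie_act V (x j) w by rewrite -tnth_nth tnth_mktuple.
have freet : free t.
  apply/freeP => c c0 j.
  have Tc0 : T w *m (\col_j c j) = 0.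
    by rewrite TE -[RHS]c0; apply: eq_bigr => i _; rewrite mxE t_nth.
  have : \col_j c j = 0.
    by rewrite -(mulKmx LT_unit (\col_j c j)) -mulmxA Tc0 !mulmx0.
  by move=> /colP/(_ j); rewrite !mxE.
have subt : (<<t>> <= orb w)%VS.
  apply/span_subvP => y /tnthP[j ->]; rewrite tnth_mktuple; apply/orbP.
  by exists (x j) => //; exact: xl.
(* By rank and nullity, a minimal stabilizer at [v] means a maximal [g.v]. *)
have le_orb : (\dim (orb w) <= r)%N.
  by rewrite -(leq_add2l (\dim (lie_stab V v))) dim_orb -(dim_orb w) leq_add2r regv.
have dimt : \dim <<t>> = r by move: freet; rewrite /free size_tuple => /eqP.
have /eqP spant : <<t>>%VS == orb w by rewrite eqEdim subt dimt.
have dim_w : \dim (orb w) = r by rewrite -spant.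
split=> [u|y /orbP].
  have -> : \dim (lie_stab V w) = \dim (lie_stab V v).
    by apply/eqP; rewrite -(eqn_add2r r) -{1}dim_w !dim_orb.
  exact: regv.
rewrite -spant => /coord_span ->; exists (\col_j coord t j y).
by rewrite TE; apply: eq_bigr => j _; rewrite mxE t_nth.
Qed.

(** Cramer's rule with [f = det (L T)] and the polynomial vector [z = adj (L T) L F]: if
    [F w = T w y], then [z w = f(w) y]. The identity extends from the locus where [f] is nonzero. *)
Lemma Vreg_denominator F v : polymap F ->
    (forall w, Vreg V w -> lie_orbit V w (F w)) -> Vreg V v ->
  exists (f : {mpoly k[m]}) (H : 'cV[k]_m -> 'cV[k]_N),
    [/\ peval f v != 0, forall w, peval f w != 0 -> Vreg V w,
        Mor_lie G m H & forall w, lie_act V (H w) w = peval f w *: F w].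
Proof.
move=> /polymapP pF Forb regv.
have [r [x [L [xl]]]] := Vreg_local_basis regv.
pose T w := \matrix_(i < m, j < r) lie_act V (x j) w i 0.
rewrite -/(T v) => LTv TP.
have pT i j : polyfun (fun w => T w i j).
  under eq_fun do rewrite mxE.
  have /polymapP pxj : polymap (fun w => lie_act V (x j) w).
    by apply: polymap_lie_act; apply/polymapP => l; exact: polyfunC.
  exact: pxj.
have pLT i j : polyfun (fun w => (L *m T w) i j).
  by apply: polyfun_mulmx => // ? ?; exact: polyfunC.
have [f fE] := polyfun_det pLT.
pose z w := \adj (L *m T w) *m (L *m F w).
have pz j : polyfun (fun w => z w j 0).
  apply: polyfun_mulmx => [i' j'|i' j']; first exact: polyfun_adj.
  by apply: polyfun_mulmx => [? ?|? j0]; [exact: polyfunC|rewrite ord1].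
pose H w := \sum_j z w j 0 *: x j.
have pH : polymap H.
  apply/polymapP => i; under eq_fun do rewrite summxE; apply: polyfun_sum => j.
  by under eq_fun do rewrite mxE; apply: polyfunM => //; exact: polyfunC.
have fv : peval f v != 0 by rewrite -fE LTv det1 oner_neq0.
have f0 : f != 0 by apply: contraNneq fv => ->; exact/eqP/(rmorph0 (evalp v)).
exists f, H; split=> // [w||w].
- by rewrite -fE => /TP[].
- by split=> // w; apply: memv_suml => j _; exact: memvZ.
apply/colP => i; move: w.
apply: (polyfun_eq f0).
- by have /polymapP pVH := polymap_lie_act pH; exact: pVH.
- by under eq_fun do rewrite mxE; apply: polyfunM => //; exact: polyfun_peval.
move=> w fw; move: (fw); rewrite -fE => /TP[regw /(_ _ (Forb w regw))[y Dy]].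
suff -> : lie_act V (H w) w = \det (L *m T w) *: F w by [].
rewrite lie_act_sum.
have -> : z w = \det (L *m T w) *: y.
  by rewrite /z Dy mulmxA mulmxA mul_adj_mx mul_scalar_mx.
rewrite [in RHS]Dy scalemxAr; apply/colP => l; rewrite summxE mxE.
by apply: eq_bigr => j _; rewrite !mxE mulrC.
Qed.
End Module.

(** * Sections of the stabilizer bundle and the lift *)

Section LieValuedMorphisms.
Variables (k : closedFieldType) (G : affine_alggroup k) (m : nat).
Variable V : rational_module G m.
Notation N := (ag_dim G).

Lemma Mor_lieD H K : Mor_lie G m H -> Mor_lie G m K ->
  Mor_lie G m (fun v => H v + K v).
Proof.
move=> [/polymapP pH lH] [/polymapP pK lK]; split=> [|v]; last exact: memvD.
by apply/polymapP => i; under eq_fun do rewrite mxE; exact: polyfunD.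
Qed.

Lemma Mor_lieZ p H : Mor_lie G m H -> Mor_lie G m (fun v => peval p v *: H v).
Proof.
move=> [/polymapP pH lH]; split=> [|v]; last exact: memvZ.
apply/polymapP => i; under eq_fun do rewrite mxE.
by apply: polyfunM => //; exact: polyfun_peval.
Qed.

Lemma Mor_lie_comb r (c : 'I_r -> {mpoly k[m]}) B : (forall j, Mor_lie G m (B j)) ->
  Mor_lie G m (fun v => \sum_j peval (c j) v *: B j v).
Proof.
move=> lB; split=> [|v]; last first.
  by apply: memv_suml => j _; apply: memvZ; case: (lB j).
apply/polymapP => i; under eq_fun do rewrite summxE.
by apply: polyfun_sum => j; case: (Mor_lieZ (c j) (lB j)) => /polymapP.
Qed.

Lemma polymap_col_mx p (F : 'cV[k]_m -> 'cV[k]_p) : polymap F ->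
  polymap (fun v => col_mx v (F v)).
Proof.
move=> /polymapP pF; apply/polymapP => i; under eq_fun do rewrite mxE.
by case: split => j //; exact: polyfun_coord.
Qed.

Lemma Vreg_dense : exists2 h : {mpoly k[m]}, h != 0 &
  forall v, peval h v != 0 -> Vreg V v.
Proof.
have [v regv] := Vreg_nonempty V.
(* The zero map is a convenient input: only the polynomial [f] is wanted. *)
have [||h [_ [hv hV _ _]]] := @Vreg_denominator _ _ _ V (fun=> 0) v _ _ regv.
- by apply/polymapP => i; under eq_fun do rewrite mxE; exact: polyfunC.
- by move=> w _; exists 0; [exact: mem0v|exact: lie_act0].
by exists h => //; apply: contraNneq hv => ->; exact/eqP/(rmorph0 (evalp v)).
Qed.

(* The sections of the bundle of stabilizers extend to morphisms on the whole
   module, and so do their coordinates in a trivialization. *)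
Lemma stab_morphisms_free :
    trivial_bundle (Vreg V) (lie_stab V) -> codim_geq 3 (~` Vreg V) ->
  exists (r : nat) (B : 'I_r -> 'cV[k]_m -> 'cV[k]_N),
    [/\ forall j, Mor_lie G m (B j), forall j v, lie_act V (B j v) v = 0,
        forall K, Mor_lie G m K -> (forall v, lie_act V (K v) v = 0) ->
          exists c : 'I_r -> {mpoly k[m]},
            forall v, K v = \sum_j peval (c j) v *: B j v &
        forall c : 'I_r -> {mpoly k[m]},
          (forall v, \sum_j peval (c j) v *: B j v = 0) -> forall j, c j = 0].
Proof.
move=> [r [Phi [Psi [rPhi rPsi PP]]]] cZ.
have [h h0 hV] := Vreg_dense.
have hZ v : peval h v != 0 -> ~ (~` Vreg V) v by move=> /hV ? /(_ _).
have extend s : regular_fun (Vreg V) s ->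
    exists p : {mpoly k[m]}, forall v, Vreg V v -> s v = peval p v.
  rewrite -{1}[Vreg V]setCK => /(regular_fun_polynomial cZ h0 hZ)[p pE].
  by exists p => v regv; apply: pE => /(_ regv).
(* The basis comes from the constant sections [delta_mx j 0], carried over by [Phi]. *)
have Bpoly j i : exists p : {mpoly k[m]},
    forall v, Vreg V v -> Phi v (delta_mx j 0) i 0 = peval p v.
  apply: extend.
  have pd : polymap (fun _ : 'cV[k]_m => delta_mx j 0 : 'cV[k]_r).
    by apply/polymapP => l; exact: polyfunC.
  have := regular_fun_comp (polymap_col_mx pd) _ (rPhi i).
  move=> /(_ (Vreg V)) /=.
  under [X in regular_fun _ X]eq_fun do rewrite /= col_mxKu col_mxKd.
  by apply=> v regv; rewrite /= col_mxKu.
pose B j v := \col_i peval (sval (cid (Bpoly j i))) v.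
have BE j v : Vreg V v -> B j v = Phi v (delta_mx j 0).
  by move=> regv; apply/colP => i; rewrite mxE; case: cid => p /= ->.
have pB j : polymap (B j).
  by apply/polymapP => i; under eq_fun do rewrite mxE; exact: polyfun_peval.
have Bstab j v : Vreg V v -> B j v \in lie_stab V v.
  by move=> regv; rewrite BE //; case: (PP v regv).
have PhiE v (c : 'cV[k]_r) : Vreg V v -> Phi v c = \sum_j c j 0 *: B j v.
  move=> regv; have [Phil _ _ _] := PP v regv.
  have Phi0 : Phi v 0 = 0.
    by have := Phil (-1) 0 0; rewrite !scaleN1r oppr0 addr0 addNr.
  rewrite {1}[c]matrix_sum_delta exchange_big big_ord1.
  elim/big_rec2: _ => // j y z _ <-.
  by rewrite Phil BE.
have lB j : Mor_lie G m (B j).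
  split; first exact: pB.
  by apply: (lie_algebra_of_dense h0 (pB j)) => v /hV/(Bstab j)/lie_stabP[].
exists r, B; split=> [//|j v|K [pK lK] K0|c c0 j].
- apply/colP => i; rewrite [RHS]mxE; move: v.
  apply: (polyfun_eq h0 _ (polyfunC _ 0)).
    by have /polymapP := polymap_lie_act V (pB j); apply.
  by move=> w /hV/(Bstab j)/lie_stabP[_ ->]; rewrite mxE.
- have Kstab v : K v \in lie_stab V v by apply/lie_stabP; split.
  have cpoly j : exists p : {mpoly k[m]},
      forall v, Vreg V v -> Psi v (K v) j 0 = peval p v.
    apply: extend.
    have := regular_fun_comp (polymap_col_mx pK) _ (rPsi j).
    move=> /(_ (Vreg V)) /=.
    under [X in regular_fun _ X]eq_fun do rewrite /= col_mxKu col_mxKd.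
    by apply=> v regv; rewrite /total_space /= col_mxKu col_mxKd.
  exists (fun j => sval (cid (cpoly j))) => v; apply/colP => i; move: v.
  apply: (polyfun_eq h0).
  + by have /polymapP := pK; apply.
  + have [/polymapP + _] : Mor_lie G m
        (fun v => \sum_j peval (sval (cid (cpoly j))) v *: B j v).
      exact: Mor_lie_comb.
    exact.
  move=> v /hV regv; have [_ _ _ PhiPsi] := PP v regv.
  rewrite -{1}(PhiPsi _ (Kstab v)) PhiE //.
  suff -> : \sum_j Psi v (K v) j 0 *: B j v =
    \sum_j peval (sval (cid (cpoly j))) v *: B j v by [].
  by apply: eq_bigr => j _; case: cid => p /= ->.
- apply: evalp_inj => v; rewrite rmorph0; move: v.
  apply: (polyfun_eq h0 (polyfun_peval _) (polyfunC _ 0)) => v /hV regv.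
  have [Phil _ PsiPhi _] := PP v regv.
  have Phi0 : Phi v 0 = 0.
    by have := Phil (-1) 0 0; rewrite !scaleN1r oppr0 addr0 addNr.
  have : Phi v (\col_j peval (c j) v) = 0.
    by rewrite PhiE // -[RHS](c0 v); apply: eq_bigr => i _; rewrite mxE.
  rewrite -Phi0 => /(congr1 (Psi v)); rewrite !PsiPhi => /colP/(_ j).
  by rewrite !mxE.
Qed.

(* [h_1, h_2, h_3] is a regular sequence of denominators, [h_i F = H_i . v].
   The morphisms [h_i H_j - h_j H_i] take values in the stabilizers; exactness
   of the Koszul complex at their coordinates corrects [H_1] and [H_2] so that
   [h_1 H_2 = h_2 H_1], whence [h_1] divides [H_1]. *)
Lemma lift_of_orbit_valued F :
    trivial_bundle (Vreg V) (lie_stab V) -> codim_geq 3 (~` Vreg V) ->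
    Mor m m F -> (forall v, Vreg V v -> lie_orbit V v (F v)) ->
  exists2 F', Mor_lie G m F' & forall v, F v = lie_act V (F' v) v.
Proof.
move=> triv cZ pF Forb.
pose D := [set f : {mpoly k[m]} | exists2 H, Mor_lie G m H &
  forall w, lie_act V (H w) w = peval f w *: F w].
have ID : is_ideal D.
  split=> [|f g [H lH HE] [K lK KE]|a f [H lH HE]].
  - exists (fun=> 0); last first.
      by move=> w; rewrite lie_act0 -/(evalp w _) rmorph0 scale0r.
    split=> [|v]; last exact: mem0v.
    by apply/polymapP => i; under eq_fun do rewrite mxE; exact: polyfunC.
  - exists (fun v => H v + K v); first exact: Mor_lieD.
    by move=> w; rewrite lie_actD HE KE -/(evalp w (f + g)) rmorphD scalerDl.
  - exists (fun v => peval a v *: H v); first exact: Mor_lieZ.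
    by move=> w; rewrite lie_actZ HE -/(evalp w (a * f)) rmorphM scalerA.
have DZ : zeros D `<=` ~` Vreg V.
  move=> v Dv regv; have [f [H [fv _ lH HE]]] := Vreg_denominator pF Forb regv.
  by move: fv; rewrite Dv ?eqxx //; exists H.
have nZ : ~ (setT `<=` ~` Vreg V).
  by have [v regv] := Vreg_nonempty V; move=> /(_ v I).
have [h1 [h2 [h3 [[H1 l1 E1] [H2 l2 E2] [H3 l3 E3] [h10 reg2 reg3]]]]] :=
  exists_regular_triple ID DZ cZ nZ.
have [r [B [lB B0 coord indep]]] := stab_morphisms_free triv cZ.
have cross f g H K : Mor_lie G m H -> Mor_lie G m K ->
    (forall w, lie_act V (H w) w = peval f w *: F w) ->
    (forall w, lie_act V (K w) w = peval g w *: F w) ->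
  exists c : 'I_r -> {mpoly k[m]}, forall v,
    peval f v *: K v - peval g v *: H v = \sum_j peval (c j) v *: B j v.
  move=> lH lK HE KE.
  have [|v|c cE] := coord (fun v => peval f v *: K v + peval (- g) v *: H v).
  - by apply: Mor_lieD; exact: Mor_lieZ.
  - rewrite lie_actD !lie_actZ HE KE -!/(evalp v _) rmorphN !scalerA mulrC.
    by rewrite mulNr scaleNr subrr.
  by exists c => v; rewrite -cE -/(evalp v (- g)) rmorphN scaleNr.
have [c12 c12E] := cross _ _ _ _ l1 l2 E1 E2.
have [c23 c23E] := cross _ _ _ _ l2 l3 E2 E3.
have [c31 c31E] := cross _ _ _ _ l3 l1 E3 E1.
(* The combination [h3 (h1 H2 - h2 H1) + h1 (h2 H3 - h3 H2) + h2 (h3 H1 - h1 H3)] is identically 0,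
   and [indep] transfers this to coordinates. *)
have koszul j : h3 * c12 j = h1 * (- c23 j) + h2 * (- c31 j).
  apply/eqP; rewrite -subr_eq0 opprD -!mulrN !opprK; apply/eqP; move: j.
  apply: indep => v.
  have -> : \sum_j peval (h3 * c12 j + (h1 * c23 j + h2 * c31 j)) v *: B j v =
      peval h3 v *: (peval h1 v *: H2 v - peval h2 v *: H1 v) +
      (peval h1 v *: (peval h2 v *: H3 v - peval h3 v *: H2 v) +
       peval h2 v *: (peval h3 v *: H1 v - peval h1 v *: H3 v)).
    rewrite c12E c23E c31E !scaler_sumr -!big_split; apply: eq_bigr => j _ /=.
    by rewrite -!/(evalp v _) !rmorphD !rmorphM !scalerDl !scalerA.
  by apply/colP => i; rewrite !mxE; ring.
have c12_split j : exists a b, c12 j = h1 * a + h2 * b by exact: reg3 (koszul j).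
have [a ab] := choice c12_split; have [b {}ab] := choice ab.
(* Writing [A], [B'] for the sections with coordinates [a], [b], one has
   [h1 H2 - h2 H1 = h1 A + h2 B'], that is [h2 (H1 + B') = h1 (H2 - A)]. *)
pose K1 v := H1 v + \sum_j peval (b j) v *: B j v.
pose K2 v := H2 v + \sum_j peval (- a j) v *: B j v.
have lK1 : Mor_lie G m K1 by apply: Mor_lieD => //; exact: Mor_lie_comb.
have lK2 : Mor_lie G m K2 by apply: Mor_lieD => //; exact: Mor_lie_comb.
have K12 v : peval h2 v *: K1 v = peval h1 v *: K2 v.
  have := c12E v; rewrite /K1 /K2.
  have -> : \sum_j peval (c12 j) v *: B j v =
      peval h1 v *: (\sum_j peval (a j) v *: B j v) +
      peval h2 v *: (\sum_j peval (b j) v *: B j v).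
    rewrite !scaler_sumr -big_split; apply: eq_bigr => j _ /=.
    by rewrite ab -/(evalp v (_ + _)) rmorphD !rmorphM scalerDl !scalerA.
  have -> : \sum_j peval (- a j) v *: B j v = - \sum_j peval (a j) v *: B j v.
    rewrite -sumrN; apply: eq_bigr => j _.
    by rewrite -/(evalp v (- a j)) rmorphN scaleNr.
  set Sa := \sum_j _; set Sb := \sum_j _ => E.
  apply/eqP; rewrite -subr_eq0; apply/eqP.
  transitivity (peval h1 v *: Sa + peval h2 v *: Sb -
      (peval h1 v *: H2 v - peval h2 v *: H1 v)); last by rewrite E subrr.
  by apply/colP => i; rewrite !mxE; ring.
have K1E v : lie_act V (K1 v) v = peval h1 v *: F v.
  by rewrite lie_actD E1 lie_act_sum big1 ?addr0 // => j _; rewrite B0 scaler0.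
have [[p1 p1E] _] := lK1; have [[p2 p2E] _] := lK2.
have dvd i : exists q, p1 i = h1 * q.
  apply: (reg2 (p2 i)); apply: evalp_inj => v.
  rewrite !rmorphM /= /evalp -p1E -p2E.
  by have /colP/(_ i) := K12 v; rewrite !mxE.
have [q qE] := choice dvd.
pose F' v := \col_i peval (q i) v.
have F'E v : K1 v = peval h1 v *: F' v.
  by apply/colP => i; rewrite p1E qE !mxE -!/(evalp v _) rmorphM.
have pF' : polymap F'.
  by apply/polymapP => i; under eq_fun do rewrite mxE; exact: polyfun_peval.
exists F'.
  split; first exact: pF'.
  apply: (lie_algebra_of_dense h10 pF') => v h1v.
  have [_ /(_ v)] := lK1; rewrite F'E => /(memvZ (peval h1 v)^-1).
  by rewrite scalerA mulVf // scale1r.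
move=> v; apply/colP => i; move: v; apply: (polyfun_eq h10).
- by have /polymapP := pF; apply.
- by have /polymapP := polymap_lie_act V pF'; apply.
move=> v h1v; suff -> : F v = lie_act V (F' v) v by [].
by apply: (scalerI h1v); rewrite -K1E F'E lie_actZ.
Qed.

End LieValuedMorphisms.

Theorem proposition3p1 (k : closedFieldType) (char0 : [pchar k] =i pred0)
    (G : affine_alggroup k) (G_connected : connected_alggroup G)
    (m : nat) (V : rational_module G m)
    (E'_trivial : trivial_bundle (Vreg V) (lie_stab V))
    (codim_ge3 : codim_geq 3 (~` Vreg V)) :
  phi_hat V @` Mor_lie G m =
    [set F | Mor m m F /\ forall v, lie_orbit V v (F v)] /\
  (forall F, Mor m m F -> (forall v, Vreg V v -> lie_orbit V v (F v)) ->
     exists2 F', Mor_lie G m F' & forall v, F v = lie_act V (F' v) v).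
Proof.
split=> [|F pF Forb]; last exact: lift_of_orbit_valued.
apply/seteqP; split=> [_ [F [pF lF] <-]|F [pF Forb]].
  by split=> [|v]; [exact: polymap_lie_act|exists (F v); first exact: lF].
have [F' lF' FE] := lift_of_orbit_valued E'_trivial codim_ge3 pF (fun v _ => Forb v).
by exists F' => //; apply/funext => v; rewrite FE.
Qed.
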